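(* Let $d\ge 2$ and let $Z\subset\mathbb{R}^d$ be a full-dimensional zonotope with $Z=-Z$. If $Z$ is vertex-transitive, then $Z$ is a $\Gamma$-permutahedron for some finite reflection group $\Gamma\subset \mathrm{O}(\mathbb{R}^d)$.
   Context: A zonotope is a polytope (convex hull of finitely many points) that is a Minkowski sum of finitely many line segments. For a polytope $P\subset\mathbb{R}^d$, $\mathrm{Aut}(P)=\{T\in\mathrm{O}(\mathbb{R}^d)\mid TP=P\}$, and $P$ is vertex-transitive if $\mathrm{Aut}(P)$ acts transitively on the set of vertices of $P$. A finite reflection group $\Gamma\subset\mathrm{O}(\mathbb{R}^d)$ is a finite group generated by reflections $T_r=\mathrm{Id}-2rr^{\top}/\|r\|^2$, $r\in R$, for some finite set $R\subset\mathbb{R}^d\setminus\{0\}$. A $\Gamma$-permutahedron is a polytope $P\subset\mathbb{R}^d$ such that $\Gamma$ acts regularly (that is, transitively and freely) on the vertices of $P$. Equivalently, $P=\mathrm{conv}(\Gamma v)$ for a point $v$ in the interior of a Weyl chamber of $\Gamma$, i.e. a point $v$ not lying on any reflection hyperplane of $\Gamma$. *)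

(* Defs.v *)
From mathcomp Require Import all_boot all_order all_algebra.
From mathcomp Require Import boolp classical_sets cardinality reals convex.

Set Implicit Arguments.
Unset Strict Implicit.
Unset Printing Implicit Defensive.

Import Order.TTheory GRing.Theory Num.Theory.

Local Open Scope classical_set_scope.
Local Open Scope ring_scope.

(* Points of R^d are column vectors; a linear map T acts by x |-> T *m x. *)

Definition dotmul (R : realType) (d : nat) (u v : 'cV[R]_d) : R :=
  (u^T *m v) 0 0.

Definition convex_hull (R : realType) (d : nat) (A : set 'cV[R]_d) :
  set 'cV[R]_d := smallest (@convex_set R 'cV[R]_d) A.

Definition affine_set (R : realType) (d : nat) (A : set 'cV[R]_d) : Prop :=
  forall (x y : 'cV[R]_d) (t : R), A x -> A y -> A (t *: x + (1 - t) *: y).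

Definition affine_hull (R : realType) (d : nat) (A : set 'cV[R]_d) :
  set 'cV[R]_d := smallest (@affine_set R d) A.

Definition full_dimensional (R : realType) (d : nat) (P : set 'cV[R]_d) : Prop :=
  affine_hull P = [set: 'cV[R]_d].

Definition is_polytope (R : realType) (d : nat) (P : set 'cV[R]_d) : Prop :=
  exists A : set 'cV[R]_d, finite_set A /\ P = convex_hull A.

Definition segment (R : realType) (d : nat) (a b : 'cV[R]_d) : set 'cV[R]_d :=
  convex_hull [set a; b].

Definition minkowski_sum (R : realType) (d n : nat)
    (A : 'I_n -> set 'cV[R]_d) : set 'cV[R]_d :=
  [set \sum_(i < n) x i | x in [set x : 'I_n -> 'cV[R]_d | forall i, A i (x i)]].

Definition is_zonotope (R : realType) (d : nat) (Z : set 'cV[R]_d) : Prop :=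
  is_polytope Z /\
  exists (n : nat) (a b : 'I_n -> 'cV[R]_d),
    Z = minkowski_sum (fun i => segment (a i) (b i)).

(* Vertices are the zero-dimensional faces: v is a vertex of P when some linear
   functional attains its maximum over P at v and nowhere else. *)
Definition vertices (R : realType) (d : nat) (P : set 'cV[R]_d) :
  set 'cV[R]_d :=
  [set v | P v /\
    exists c : 'cV[R]_d, forall x, P x -> x <> v -> dotmul c x < dotmul c v].

Definition orthogonal_group (R : realType) (d : nat) : set 'M[R]_d :=
  [set T | T^T *m T = 1%:M].

Definition Aut (R : realType) (d : nat) (P : set 'cV[R]_d) : set 'M[R]_d :=
  [set T | orthogonal_group T /\ [set T *m x | x in P] = P].

Definition acts_on (R : realType) (d : nat)
    (G : set 'M[R]_d) (V : set 'cV[R]_d) : Prop :=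
  forall T v, G T -> V v -> V (T *m v).

(* A transitive action has exactly one orbit, so V must be nonempty. *)
Definition acts_transitively (R : realType) (d : nat)
    (G : set 'M[R]_d) (V : set 'cV[R]_d) : Prop :=
  [/\ acts_on G V, V !=set0
    & forall v w, V v -> V w -> exists2 T, G T & T *m v = w].

Definition acts_freely (R : realType) (d : nat)
    (G : set 'M[R]_d) (V : set 'cV[R]_d) : Prop :=
  forall T v, G T -> V v -> T *m v = v -> T = 1%:M.

Definition acts_regularly (R : realType) (d : nat)
    (G : set 'M[R]_d) (V : set 'cV[R]_d) : Prop :=
  acts_transitively G V /\ acts_freely G V.

Definition vertex_transitive (R : realType) (d : nat) (P : set 'cV[R]_d) : Prop :=
  acts_transitively (Aut P) (vertices P).

Definition is_orthogonal_subgroup (R : realType) (d : nat)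
    (G : set 'M[R]_d) : Prop :=
  [/\ G `<=` @orthogonal_group R d, G 1%:M,
      forall S T, G S -> G T -> G (S *m T)
    & forall T, G T -> G (invmx T)].

Definition reflection (R : realType) (d : nat) (r : 'cV[R]_d) : 'M[R]_d :=
  1%:M - (2 / dotmul r r) *: (r *m r^T).

(* Only meant for X `<=` orthogonal_group: otherwise no subgroup contains X and
   the intersection over the empty family is the full set. *)
Definition generated_group (R : realType) (d : nat) (X : set 'M[R]_d) :
  set 'M[R]_d := smallest (@is_orthogonal_subgroup R d) X.

Definition finite_reflection_group (R : realType) (d : nat)
    (G : set 'M[R]_d) : Prop :=
  finite_set G /\
  exists S : set 'cV[R]_d,
    [/\ finite_set S, forall r, S r -> r != 0
      & G = generated_group [set reflection r | r in S]].

Definition is_permutahedron (R : realType) (d : nat)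
    (G : set 'M[R]_d) (P : set 'cV[R]_d) : Prop :=
  is_polytope P /\ acts_regularly G (vertices P).

(* Main.v *)
Require Import Defs.
From mathcomp Require Import all_boot all_order all_algebra.
From mathcomp Require Import boolp classical_sets cardinality reals convex.
From mathcomp Require Import interval_inference.
From mathcomp Require Import ring lra.

(** Let [Z] be the sum of the segments from [- g_i] to [g_i].  Its vertices are
    the points [sum_i sgn<c, g_i> g_i], for [c] off all the hyperplanes
    orthogonal to a generator: they correspond to the chambers of a hyperplane
    arrangement.  Grouping parallel generators, let [U] be the set of unit
    vectors parallel to a generator and [w u] half the total length of the
    generators parallel to [u]; then the vertices are the sums
    [v c = sum_(u in U) w u sgn<c, u> u] ([zonotope_configuration]).

    When [c] crosses a single wall, the one orthogonal to [u], the vertex jumps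
    by a multiple of [u].  The jumps recover [U] and [w] from the vertices, so
    automorphisms of [Z] permute [U] and preserve [w] ([sign_sum_jump],
    [sign_vertex_weight]).  Therefore the zonotope with the same directions but
    all weights equal to 1 is vertex-transitive as well.  From here on only one
    consequence of transitivity matters: for the weight [w], and for the
    weight 1, all vertices are at the same distance from 0.

    Equal norms turn the jump across a wall into the reflection in that wall
    ([wall_orthogonal]).  Near a generic point of codimension two this becomes a
    condition on the directions in one plane ([plane_balanced]), which says that
    the 2-dimensional faces are inscribed in circles.  For the weight 1 these
    faces are moreover equilateral, hence regular polygons, so that the
    directions in the plane are equally spaced; an inscribed polygon with
    equally spaced directions has sides of alternating lengths.  Both facts
    together say that the reflection along a direction preserves the directions
    of the plane and their weights ([planar_mirror]), and since any two
    nonparallel directions span a plane, [U] is a root system with an invariant weight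
    ([equidistant_reflection]).

    The rest is the theory of finite reflection groups: the reflections along
    the simple roots of one chamber generate a group that acts on the vertices,
    as on the chambers, transitively ([word_dominant]) and freely ([word_free],
    by the exchange property). *)

Set Implicit Arguments.
Unset Strict Implicit.
Unset Printing Implicit Defensive.

Import Order.TTheory GRing.Theory Num.Theory.

Local Open Scope classical_set_scope.
Local Open Scope ring_scope.

Local Notation dot := dotmul.

(** * Finite sequences *)

Lemma ltn_count (T : eqType) (p q : pred T) (s : seq T) x : uniq s ->
  {in s, subpred p q} -> x \in s -> q x -> ~~ p x -> (count p s < count q s)%N.
Proof.
move=> us pq xs qx px; rewrite -!size_filter.
apply: (@uniq_leq_size _ (x :: filter p s)).
  by rewrite /= filter_uniq // mem_filter (negPf px).
move=> y; rewrite inE !mem_filter => /predU1P[->|/andP[py ys]]; first by rewrite qx.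
by rewrite ys pq.
Qed.

Lemma big_support (V : nmodType) (I : eqType) (s t : seq I) (F : I -> V) :
  uniq s -> uniq t -> {subset t <= s} ->
  (forall i, i \in s -> i \notin t -> F i = 0) ->
  \sum_(i <- s) F i = \sum_(i <- t) F i.
Proof.
move=> us ut ts F0; rewrite (bigID (mem t)) /= [X in _ + X]big_seq_cond.
rewrite [X in _ + X]big1 ?addr0 => [|i /andP[/F0 Fi /Fi]] //.
rewrite -big_filter; apply: perm_big; apply: uniq_perm => //.
  exact: filter_uniq.
by move=> i; rewrite mem_filter /=; case it : (i \in t); rewrite //= ts.
Qed.

Lemma exists_min (R : realType) (T : eqType) (F : T -> R) (s : seq T) (t : T) : t \in s ->
  exists2 m, m \in s & {in s, forall y, F m <= F y}.
Proof.
elim: s t => // a [|b s] IH t _.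
  by exists a => [|y]; rewrite inE // => /eqP ->.
have [m ms mle] := IH b (mem_head _ _).
have [am|/ltW ma] := leP (F a) (F m).
  exists a; first exact: mem_head.
  by move=> y; rewrite inE => /predU1P[->//|/mle]; apply: le_trans.
exists m; first by rewrite inE ms orbT.
by move=> y; rewrite inE => /predU1P[->|/mle].
Qed.

(** * Inner product, orthogonal matrices and reflections *)

Section DotProduct.
Variables (R : realType) (d : nat).
Implicit Types (u v x y : 'cV[R]_d) (a : R).

Lemma dotE u v : dot u v = \sum_i u i 0 * v i 0.
Proof. by rewrite /dotmul mxE; apply: eq_bigr => i _; rewrite mxE. Qed.

Lemma dotC u v : dot u v = dot v u.
Proof. by rewrite !dotE; apply: eq_bigr => i _; rewrite mulrC. Qed.

Lemma dotDr u v x : dot u (v + x) = dot u v + dot u x.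
Proof. by rewrite /dotmul mulmxDr mxE. Qed.

Lemma dotDl u v x : dot (u + v) x = dot u x + dot v x.
Proof. by rewrite dotC dotDr !(dotC x). Qed.

Lemma dotZr a u v : dot u (a *: v) = a * dot u v.
Proof. by rewrite /dotmul -scalemxAr mxE. Qed.

Lemma dotZl a u v : dot (a *: u) v = a * dot u v.
Proof. by rewrite dotC dotZr dotC. Qed.

Lemma dotNr u v : dot u (- v) = - dot u v.
Proof. by rewrite -scaleN1r dotZr mulN1r. Qed.

Lemma dotNl u v : dot (- u) v = - dot u v.
Proof. by rewrite dotC dotNr dotC. Qed.

Lemma dotBr u v x : dot u (v - x) = dot u v - dot u x.
Proof. by rewrite dotDr dotNr. Qed.

Lemma dot0r u : dot u 0 = 0.
Proof. by rewrite -(scale0r 0) dotZr mul0r. Qed.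

Definition dot_lin := (dotDr, dotDl, dotNr, dotNl, dotZr, dotZl).

Lemma dot_sumr (I : Type) (r : seq I) (P : pred I) (F : I -> 'cV[R]_d) u :
  dot u (\sum_(i <- r | P i) F i) = \sum_(i <- r | P i) dot u (F i).
Proof. exact: (big_morph (dot u) (dotDr u) (dot0r u)). Qed.

Lemma dot_ge0 u : 0 <= dot u u.
Proof. by rewrite dotE sumr_ge0 // => i _; rewrite -expr2 sqr_ge0. Qed.

Lemma dot_eq0 u : (dot u u == 0) = (u == 0).
Proof.
apply/eqP/eqP => [|->]; last exact: dot0r.
rewrite dotE => /eqP; rewrite psumr_eq0 => [/allP u0|i _]; last first.
  by rewrite -expr2 sqr_ge0.
apply/matrixP => i j; rewrite (ord1 j) mxE.
by have := u0 i (mem_index_enum i); rewrite -expr2 sqrf_eq0 => /eqP.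
Qed.

Lemma dot_gt0 u : (0 < dot u u) = (u != 0).
Proof. by rewrite lt_neqAle eq_sym dot_eq0 dot_ge0 andbT. Qed.

Lemma unit_neq0 u : dot u u = 1 -> u != 0.
Proof. by move=> u1; rewrite -dot_eq0 u1 oner_eq0. Qed.

Lemma dot_ext u v : (forall x, dot x u = dot x v) -> u = v.
Proof.
move=> uv; apply/eqP; rewrite -subr_eq0 -dot_eq0 dotBr (uv (u - v)).
by rewrite subrr.
Qed.

Lemma dot_mulmx (T : 'M[R]_d) u v : dot u (T *m v) = dot (T^T *m u) v.
Proof. by rewrite /dotmul trmx_mul trmxK mulmxA. Qed.

End DotProduct.

Section Orthogonal.
Variables (R : realType) (d : nat).
Implicit Types (T : 'M[R]_d) (u v x y : 'cV[R]_d).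

Lemma orthogonal_mulC T : orthogonal_group T -> T *m T^T = 1%:M.
Proof. by move=> /mulmx1C. Qed.

Lemma orthogonal_invmx T : orthogonal_group T -> invmx T = T^T.
Proof.
move=> oT; have uT : T \in unitmx by case/mulmx1_unit: oT.
by rewrite -[LHS]mul1mx -oT -mulmxA mulmxV // mulmx1.
Qed.

Lemma orthogonalM S T :
  orthogonal_group S -> orthogonal_group T -> orthogonal_group (S *m T).
Proof.
rewrite /orthogonal_group /= => oS oT.
by rewrite trmx_mul mulmxA -(mulmxA T^T) oS mulmx1.
Qed.

Lemma orthogonal1 : orthogonal_group (1%:M : 'M[R]_d).
Proof. by rewrite /orthogonal_group /= trmx1 mulmx1. Qed.

Lemma dot_orthogonal T u v :
  orthogonal_group T -> dot (T *m u) (T *m v) = dot u v.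
Proof. by move=> oT; rewrite dot_mulmx mulmxA oT mul1mx. Qed.

Lemma orthogonalK T u : orthogonal_group T -> T^T *m (T *m u) = u.
Proof. by move=> oT; rewrite mulmxA oT mul1mx. Qed.

Lemma orthogonalKV T u : orthogonal_group T -> T *m (T^T *m u) = u.
Proof. by move=> /orthogonal_mulC oT; rewrite mulmxA oT mul1mx. Qed.

Lemma reflectionE r x :
  reflection r *m x = x - (2 / dot r r * dot r x) *: r.
Proof.
rewrite /reflection mulmxBl mul1mx -scalemxAl -mulmxA -scalerA.
by rewrite [r^T *m x]mx11_scalar mul_mx_scalar.
Qed.

Lemma reflection_unit u x : dot u u = 1 ->
  reflection u *m x = x - (2 * dot u x) *: u.
Proof. by move=> u1; rewrite reflectionE u1 divr1. Qed.

Lemma mulmx_ext S T : (forall x : 'cV[R]_d, S *m x = T *m x) -> S = T.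
Proof.
move=> ST; apply/matrixP => i j; have := ST (delta_mx j 0).
by rewrite -!colE => /matrixP/(_ i 0); rewrite !mxE.
Qed.

Lemma orthogonalP T : (forall x y, dot (T *m x) (T *m y) = dot x y) ->
  orthogonal_group T.
Proof.
move=> Tdot; apply: mulmx_ext => x; apply: dot_ext => y.
by rewrite mul1mx -mulmxA dot_mulmx trmxK Tdot.
Qed.

Lemma reflectionK u x : dot u u = 1 ->
  reflection u *m (reflection u *m x) = x.
Proof.
move=> u1; rewrite !reflection_unit // !dot_lin u1 -addrA -opprD -scalerDl.
by rewrite [X in X *: _](_ : _ = 0) ?scale0r ?subr0 //; ring.
Qed.

Lemma reflection_self u : dot u u = 1 -> reflection u *m u = - u.
Proof.
by move=> u1; rewrite reflection_unit // u1 mulr1 scaler_nat mulr2n opprD addrA subrr add0r.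
Qed.

Lemma dot_reflection u x y : dot u u = 1 ->
  dot (reflection u *m x) y = dot x (reflection u *m y).
Proof. by move=> u1; rewrite !reflection_unit // !dot_lin (dotC x u); ring. Qed.

Lemma reflection_orthogonal u : dot u u = 1 -> orthogonal_group (reflection u).
Proof.
by move=> u1; apply: orthogonalP => x y; rewrite dot_reflection // reflectionK.
Qed.

Lemma reflection_conj T u : orthogonal_group T -> dot u u = 1 ->
  T *m reflection u = reflection (T *m u) *m T.
Proof.
move=> oT u1; apply: mulmx_ext => x; rewrite -!mulmxA !reflection_unit //.
  by rewrite mulmxBr -scalemxAr dot_orthogonal.
by rewrite dot_orthogonal.
Qed.

End Orthogonal.

(** * Signs of linear forms near a hyperplane *)

Section Perturbation.
Variables (R : realType) (d : nat).
Implicit Types (c e x : 'cV[R]_d) (s t : seq 'cV[R]_d).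

Lemma sgr_perturb (p q : R) : exists2 b, 0 < b & forall a, 0 < a <= b ->
  Num.sg (p + a * q) = if p == 0 then Num.sg q else Num.sg p.
Proof.
have [->|p0] := eqVneq p 0.
  by exists 1 => // a /andP[a0 _]; rewrite add0r sgrM gtr0_sg // mul1r.
have q1 : 0 < `|q| + 1 by rewrite ltr_pwDr.
exists (`|p| / (`|q| + 1)); first by rewrite divr_gt0 ?normr_gt0.
move=> a /andP[a0]; rewrite ler_pdivlMr // mulrDr mulr1 => apq.
have {apq} : `|a * q| < `|p| by rewrite normrM gtr0_norm //; lra.
rewrite ltr_norml; case: (ltgtP p 0) p0 => // p0 _.
  by rewrite ltr0_norm // => /andP[h1 h2]; rewrite !ltr0_sg //; lra.
by rewrite gtr0_norm // => /andP[h1 h2]; rewrite !gtr0_sg //; lra.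
Qed.

(** A small move from [c] in the direction [e] only changes the signs of the
    linear forms that vanish at [c]. *)
Lemma perturb c e s : exists a, forall x, x \in s ->
  Num.sg (dot (c + a *: e) x) =
  if dot c x == 0 then Num.sg (dot e x) else Num.sg (dot c x).
Proof.
suff [b b0 /(_ b)] : exists2 b, 0 < b & forall a, 0 < a <= b ->
    forall x, x \in s -> Num.sg (dot (c + a *: e) x) =
      if dot c x == 0 then Num.sg (dot e x) else Num.sg (dot c x).
  by rewrite b0 lexx => /(_ isT); exists b.
elim: s => [|x s [b b0 IH]]; first by exists 1.
have [b' b'0 H] := sgr_perturb (dot c x) (dot e x).
exists (Num.min b b'); first by rewrite lt_min b0.
move=> a; rewrite le_min => /and3P[a0 ab ab'] y; rewrite inE => /orP[/eqP->|ys].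
  by rewrite dotDl dotZl H // a0.
by apply: IH => //; rewrite a0.
Qed.

(** Each hyperplane is avoided in turn by a move along its own normal, small
    enough to keep the signs already obtained. *)
Lemma perturb_generic c s : exists c', forall x, x \in s ->
  (dot c x != 0 -> Num.sg (dot c' x) = Num.sg (dot c x)) /\
  (x != 0 -> dot c' x != 0).
Proof.
suff H t : exists c', (forall x, x \in s -> dot c x != 0 ->
    Num.sg (dot c' x) = Num.sg (dot c x)) /\
    (forall x, x \in t -> x != 0 -> dot c' x != 0).
  have [c' [c'1 c'2]] := H s.
  by exists c' => x xs; split; [exact: c'1|exact: c'2].
elim: t => [|x t [c1 [c1s c1t]]]; first by exists c.
have [c1x|c1x] := eqVneq (dot c1 x) 0; last first.
  by exists c1; split=> // y; rewrite inE => /predU1P[->|/c1t].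
have [a ha] := perturb c1 x (x :: s ++ t).
exists (c1 + a *: x); split=> [y ys cy0|y].
  have c1y0 : dot c1 y != 0 by rewrite -sgr_eq0 c1s // sgr_eq0.
  by rewrite ha ?inE ?mem_cat ?ys ?orbT // (negPf c1y0) c1s.
rewrite inE => yxt y0; rewrite -sgr_eq0 ha ?inE ?mem_cat; last first.
  by case/orP: yxt => ->; rewrite ?orbT.
have [c1y|c1y] := eqVneq (dot c1 y) 0; last by rewrite sgr_eq0.
case/predU1P: yxt => [yx|yt]; last by have := c1t _ yt y0; rewrite c1y eqxx.
by rewrite yx sgr_eq0 dot_eq0 -yx.
Qed.

(** Sign functions of linear forms with distinct hyperplanes are linearly
    independent.  A combination of them that is constant does not jump when a
    generic point of the hyperplane orthogonal to [e] is crossed, and only the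
    forms proportional to [e] change sign there. *)
Lemma sign_sum_jump (I : eqType) (r : seq I) (f : I -> 'cV[R]_d) (a : I -> R)
    (K : R) e :
  (forall c, (forall i, i \in r -> f i != 0 -> dot c (f i) != 0) ->
    \sum_(i <- r) Num.sg (dot c (f i)) * a i = K) ->
  dot e e = 1 ->
  \sum_(i <- r | f i == dot e (f i) *: e) Num.sg (dot e (f i)) * a i = 0.
Proof.
move=> FK e1.
pose p x : 'cV[R]_d := x - dot e x *: e.
have dotp x y : dot (p x) y = dot x (p y).
  by rewrite /p !dot_lin (dotC x e); ring.
(* A generic point [c] of the hyperplane orthogonal to [e]: project a point that
   is generic for the projections of the [f i]. *)
have [c1 hc1] := perturb_generic 0 (map (p \o f) r).
pose c : 'cV[R]_d := p c1.
have ce : dot c e = 0.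
  by rewrite dotp /p e1 scale1r subrr dot0r.
have cf i : i \in r -> (dot c (f i) == 0) = (f i == dot e (f i) *: e).
  move=> ir; apply/eqP/eqP => [|->]; last by rewrite dotZr ce mulr0.
  rewrite dotp => c0; apply/eqP; rewrite -subr_eq0; apply: contra_eqT c0.
  by have [_] := hc1 _ (map_f (p \o f) ir).
pose P i := f i == dot e (f i) *: e.
have jump v : dot v v = 1 -> v = dot e v *: e ->
    \sum_(i <- r | ~~ P i) Num.sg (dot c (f i)) * a i +
    \sum_(i <- r | P i) Num.sg (dot v (f i)) * a i = K.
  move=> v1 ve; have [b hb] := perturb c v (map f r).
  have ev0 : dot e v != 0.
    apply: contra_eqN v1 => /eqP ev0; rewrite ve ev0 scale0r dot0r.
    by rewrite eq_sym oner_eq0.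
  rewrite -(FK (c + b *: v)) => [|i ir fi0]; last first.
    rewrite -sgr_eq0 hb ?map_f // cf //; case: ifPn => [/eqP fi|].
      rewrite sgr_eq0 ve dotZl mulf_neq0 //.
      by apply: contraNneq fi0 => ef; rewrite fi ef scale0r.
    by rewrite -cf // sgr_eq0.
  rewrite [RHS](bigID P) /= addrC; congr (_ + _);
    rewrite big_seq_cond [RHS]big_seq_cond; apply: eq_bigr => i /andP[ir].
    by rewrite hb ?map_f // cf // /P => /negPf ->.
  by rewrite hb ?map_f // cf // /P => ->.
have Je : e = dot e e *: e by rewrite e1 scale1r.
have JN : - e = dot e (- e) *: e by rewrite dotNr e1 scaleN1r.
(* The two sides of the hyperplane are reached along [e] and [- e]. *)
have := jump _ _ JN; rewrite dotNr dotNl opprK e1 => /(_ erefl).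
rewrite -[in RHS](jump _ e1 Je) => /addrI.
under eq_bigr => i _ do rewrite dotNl sgrN mulNr.
by rewrite sumrN /P => S0; lra.
Qed.

End Perturbation.

(** * Inscribed centrally symmetric polygons *)

Section PlanarConfigurations.
Variable R : realType.
Implicit Types (x y z a b v : R * R) (w : R * R -> R).

Definition pdot x y : R := x.1 * y.1 + x.2 * y.2.
Definition pdet x y : R := x.1 * y.2 - x.2 * y.1.
(** For a unit vector [a], the reflection of the plane that fixes the line of [a],
    that is, minus the reflection along [a]. *)
Definition pmirror a x : R * R :=
  (2 * pdot a x * a.1 - x.1, 2 * pdot a x * a.2 - x.2).

Lemma pdetC x y : pdet y x = - pdet x y.
Proof. by rewrite /pdet; ring. Qed.

Lemma pdet_decomp a x y : pdot a a = 1 ->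
  pdot x y = pdot x a * pdot a y + pdet a x * pdet a y.
Proof. by rewrite /pdot /pdet => a1; rewrite -[LHS]mul1r -a1; ring. Qed.

Lemma pair_decomp a x : pdot a a = 1 ->
  x = (pdot a x * a.1 - pdet a x * a.2, pdot a x * a.2 + pdet a x * a.1).
Proof.
case: x => x1 x2; rewrite /pdot /pdet /= => a1.
by congr pair; rewrite -[LHS]mul1r -a1; ring.
Qed.

Lemma pair_ext a x y : pdot a a = 1 ->
  pdot a x = pdot a y -> pdet a x = pdet a y -> x = y.
Proof. by move=> a1 e1 e2; rewrite (pair_decomp x a1) (pair_decomp y a1) e1 e2. Qed.

Lemma pdet0_unit a x : pdot a a = 1 -> pdot x x = 1 -> pdet a x = 0 ->
  x = a \/ x = - a.
Proof.
move=> a1 x1 ax0; have := pdet_decomp x x a1.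
rewrite ax0 x1 mul0r addr0 => /esym p2.
have : (pdot x a - 1) * (pdot x a + 1) = 0.
  by move: p2; rewrite /pdot; nra.
move/eqP; rewrite mulf_eq0 => /orP[]/eqP p; [left|right];
  apply: (pair_ext a1).
- by move: p; rewrite a1 /pdot; lra.
- by rewrite ax0 /pdet; ring.
- by move: p a1; rewrite /pdot /=; lra.
- by rewrite ax0 /pdet /=; ring.
Qed.

Variables (A : seq (R * R)).
Hypotheses (uniqA : uniq A) (unitA : {in A, forall x, pdot x x = 1})
  (oppA : {in A, forall x, - x \in A}).

(** In the polygon that is the sum of the segments from [- w x *: x] to
    [w x *: x], the middle of the edge of direction [a] is the sum of the vectors
    [w x * sg (pdet a x) *: x].  The condition says that the segment from the
    centre to this point is orthogonal to the edge, as in a polygon inscribed in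
    a circle. *)
Definition balanced w := {in A, forall a,
  \sum_(x <- A) w x * (Num.sg (pdet a x) * pdot a x) = 0}.

Definition even_weight w := {in A, forall x, w (- x) = w x}.

Definition consecutive x y := [&& x \in A, y \in A, 0 < pdet x y &
  all (fun z => ~~ ((0 < pdet x z) && (0 < pdet z y))) A].

Lemma consecutiveP x y : consecutive x y ->
  [/\ x \in A, y \in A, 0 < pdet x y &
    forall z, z \in A -> 0 < pdet x z -> 0 < pdet z y -> False].
Proof.
case/and4P => xA yA xy /allP H; split=> // z /H /negP zA xz zy.
by apply: zA; rewrite xz zy.
Qed.

(** Rotating the half-plane bounded by [x] to the one bounded by the next
    direction [y] only affects the signs of [x], [- x], [y] and [- y]. *)
Lemma sign_step w v x y : even_weight w -> consecutive x y ->
  \sum_(z <- A) w z * (Num.sg (pdet y z) * pdot v z) =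
  \sum_(z <- A) w z * (Num.sg (pdet x z) * pdot v z)
    - 2 * w x * pdot v x - 2 * w y * pdot v y.
Proof.
move=> wN /consecutiveP[xA yA xy nz].
have x1 := unitA xA; have y1 := unitA yA.
have oppN z : z \in A -> z != - z.
  move=> zA; apply/eqP => zN; have := unitA zA.
  by rewrite {2}zN; have := unitA zA; rewrite /pdot /=; lra.
have [xN yN] := (oppN x xA, oppN y yA).
have yx : y != x by apply: contraTneq xy => ->; rewrite /pdet; lra.
have yNx : y != - x by apply: contraTneq xy => ->; rewrite /pdet /=; lra.
(* The other directions are strictly on the same side of [x] and of [y]. *)
have sg_xy : forall z, z \in A -> z \notin [:: x; - x; y; - y] ->
    Num.sg (pdet y z) = Num.sg (pdet x z).
  move=> z zA; rewrite !inE !negb_or => /and4P[zx zNx zy zNy].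
  have xz0 : pdet x z != 0.
    apply/eqP => /(pdet0_unit x1 (unitA zA))[] /eqP; first by rewrite (negPf zx).
    by rewrite (negPf zNx).
  have yz0 : pdet y z != 0.
    apply/eqP => /(pdet0_unit y1 (unitA zA))[] /eqP; first by rewrite (negPf zy).
    by rewrite (negPf zNy).
  have h1 := nz z zA; have h2 := nz (- z) (oppA zA).
  have e1 : pdet x (- z) = - pdet x z by rewrite /pdet /=; ring.
  have e2 : pdet (- z) y = pdet y z by rewrite /pdet /=; ring.
  rewrite (pdetC y z) in h1; rewrite e1 e2 oppr_gt0 in h2; rewrite oppr_gt0 in h1.
  case: (ltgtP (pdet x z) 0) xz0 => // xz _; case: (ltgtP (pdet y z) 0) yz0 => // yz _.
  - by rewrite !ltr0_sg.
  - by case: (h2 xz yz).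
  - by case: (h1 xz yz).
  - by rewrite !gtr0_sg.
apply/eqP; rewrite -addrA addrC -subr_eq -sumrB; apply/eqP.
rewrite (@big_support _ _ A [:: x; - x; y; - y]) //.
- rewrite !big_cons big_nil !wN //.
  have e z : pdet z (- x) = pdet x z /\ pdet z (- y) = pdet y z.
    by rewrite /pdet /=; split; ring.
  have f z : pdet z z = 0 by rewrite /pdet; ring.
  rewrite !(e _).1 !(e _).2 !f (pdetC x y) sgrN gtr0_sg // sgr0.
  by rewrite /pdot /=; ring.
- have xNy : x != - y by rewrite -eqr_oppLR eq_sym.
  by rewrite /= !inE !negb_or eqr_opp xN yN xNy (eq_sym x) yx (eq_sym _ y) yNx.
- by move=> z; rewrite !inE => /or4P[] /eqP -> //; apply: oppA.
- by move=> z zA zn; rewrite sg_xy // subrr.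
Qed.

Definition half_width w y : R :=
  \sum_(t <- A) w t * (Num.sg (pdet y t) * pdet y t).

(** The signed sum at [y] is orthogonal to [y], so its inner product with any
    vector is determined by its length [half_width w y].  Comparing with the
    signed sums at both neighbours of [y], the turning angles [t] on both sides
    satisfy [sin t * half_width w y = 2 * (w x + w y * cos t)]. *)
Lemma consecutive_turn w x y z : even_weight w -> balanced w ->
  consecutive x y -> consecutive y z ->
  pdet x y * half_width w y = 2 * (w x + w y * pdot x y) /\
  pdet y z * half_width w y = 2 * (w z + w y * pdot y z).
Proof.
move=> wN wB xy yz; set s := half_width w y.
have [xA yA _ _] := consecutiveP xy; have [_ zA _ _] := consecutiveP yz.
have y1 := unitA yA.
have dots v : \sum_(t <- A) w t * (Num.sg (pdet y t) * pdot v t) = pdet y v * s.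
  transitivity (pdot v y * \sum_(t <- A) w t * (Num.sg (pdet y t) * pdot y t) +
    pdet y v * s); last by rewrite wB // mulr0 add0r.
  rewrite !mulr_sumr -big_split /=; apply: eq_bigr => t _.
  by rewrite (pdet_decomp v t y1); ring.
split.
  have := sign_step x wN xy; rewrite dots wB // (unitA xA) pdetC => h.
  by move: h; rewrite /pdet; lra.
have := sign_step z wN yz; rewrite dots wB // (unitA zA) => h.
by move: h; rewrite /pdot /pdet; lra.
Qed.

Hypothesis balanced1 : balanced (fun=> 1).

(** With weight 1 the previous equation becomes [cot (t / 2) = s / 2], which has
    a single solution [t]: the two turning angles at [y] coincide, so the
    neighbours of [y] are exchanged by the reflection fixing [y]. *)
Lemma consecutive_mirror x y z : consecutive x y -> consecutive y z ->
  z = pmirror y x /\ x = pmirror y z.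
Proof.
move=> xy yz; have [xA yA xy0 _] := consecutiveP xy.
have [_ zA yz0 _] := consecutiveP yz.
have [[x1 y1] z1] := (unitA xA, unitA yA, unitA zA).
have one_even : even_weight (fun=> 1) by [].
have [] := consecutive_turn one_even balanced1 xy yz.
set s := half_width _ _; rewrite !mul1r => hx hz.
have nx : pdot x y ^+ 2 + pdet x y ^+ 2 = 1.
  by rewrite -[RHS]mul1r -{1}x1 -y1 /pdot /pdet; ring.
have nz : pdot y z ^+ 2 + pdet y z ^+ 2 = 1.
  by rewrite -[RHS]mul1r -{1}y1 -z1 /pdot /pdet; ring.
(* With cosine [c] and sine [t], the angle is determined by [s]. *)
have half c t : 0 < t -> c ^+ 2 + t ^+ 2 = 1 -> t * s = 2 * (1 + c) ->
    0 < s /\ c * (s ^+ 2 + 4) = s ^+ 2 - 4.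
  move=> t0 ct ts.
  have c1 : 0 < 1 + c by nra.
  split; first by nra.
  have : (1 + c) * (s ^+ 2 * (1 - c) - 4 * (1 + c)) = 0.
    have -> : (1 + c) * (s ^+ 2 * (1 - c) - 4 * (1 + c)) =
      s ^+ 2 * (1 - c ^+ 2) - (2 * (1 + c)) ^+ 2 by ring.
    by rewrite -ts -ct; ring.
  by move/eqP; rewrite mulf_eq0 gt_eqF //= => /eqP; lra.
have [s0 cx] := half _ _ xy0 nx hx; have [_ cz] := half _ _ yz0 nz hz.
have c_eq : pdot x y = pdot y z.
  have s4 : s ^+ 2 + 4 != 0 by rewrite gt_eqF // addr_gt0 ?exprn_gt0.
  by apply: (mulIf s4); rewrite cx cz.
have t_eq : pdet x y = pdet y z.
  by apply: (mulIf (lt0r_neq0 s0)); rewrite hx hz c_eq.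
have yy u : pdot y (pmirror y u) = pdot y u /\ pdet y (pmirror y u) = - pdet y u.
  split; last by rewrite /pmirror /pdet /pdot /=; ring.
  transitivity (2 * pdot y u * pdot y y - pdot y u); last by rewrite y1; ring.
  by rewrite /pmirror /pdot /=; ring.
split; apply: (pair_ext y1); rewrite ?(yy _).1 ?(yy _).2.
- by rewrite -c_eq /pdot; ring.
- by rewrite -t_eq /pdet; ring.
- by rewrite -c_eq /pdot; ring.
- by rewrite -t_eq /pdet; ring.
Qed.

(** Now that the angles on both sides of [y] coincide, the two equations of
    [consecutive_turn] for the weight [w] differ only in [w x] and [w z]. *)
Lemma consecutive_weight w x y z : even_weight w -> balanced w ->
  consecutive x y -> consecutive y z -> w x = w z.
Proof.
move=> wN wB xy yz; have [_ _ xy0 _] := consecutiveP xy.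
have [ez _] := consecutive_mirror xy yz; have [_ /unitA y1 _ _] := consecutiveP xy.
have [hx] := consecutive_turn wN wB xy yz.
have -> : pdet y z = pdet x y by rewrite ez /pmirror /pdet /pdot /=; ring.
have -> : pdot y z = pdot x y.
  rewrite ez; transitivity (pdot x y * (2 * pdot y y - 1)).
    by rewrite /pmirror /pdot /=; ring.
  by rewrite y1; ring.
by rewrite hx; lra.
Qed.

(** Induction on the number of directions strictly between [a] and [b]: any of
    them splits the angle into two smaller ones. *)
Lemma consecutive_path a b : a \in A -> b \in A -> 0 < pdet a b ->
  exists2 l, path consecutive a l & last a l = b.
Proof.
pose between x y z := (0 < pdet x z) && (0 < pdet z y).
have [n] := ubnP (count (between a b) A).
elim: n a b => // n IH a b; rewrite ltnS => Hn aA bA ab.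
have [/hasP[x xA /andP[ax xb]]|/hasPn none] := boolP (has (between a b) A).
  (* The Pluecker relation between [a], [x], [z] and [b]. *)
  have cut z : pdet a x * pdet z b = pdet a z * pdet x b + pdet a b * pdet z x.
    by rewrite /pdet; ring.
  have xx : pdet x x = 0 by rewrite /pdet; ring.
  have xP : between a b x by rewrite /between ax.
  have [|//|//|//|l1 p1 l1x] := IH a x.
    apply: leq_trans Hn; apply: (ltn_count uniqA _ xA xP); last first.
      by rewrite /between xx ltxx andbF.
    move=> z zA /andP[az zx]; rewrite /between az /=.
    by rewrite -(pmulr_rgt0 _ ax) cut addr_gt0 // mulr_gt0.
  have [|//|//|//|l2 p2 l2x] := IH x b.
    apply: leq_trans Hn; apply: (ltn_count uniqA _ xA xP); last first.
      by rewrite /between xx ltxx.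
    move=> z zA /andP[xz zb]; rewrite /between zb andbT.
    have : pdet x b * pdet a z = pdet a x * pdet z b + pdet a b * pdet x z.
      by rewrite /pdet; ring.
    by move=> e; rewrite -(pmulr_rgt0 _ xb) e addr_gt0 // mulr_gt0.
  by exists (l1 ++ l2); rewrite ?cat_path ?last_cat l1x ?p1.
by exists [:: b]; rewrite //= andbT /consecutive aA bA ab; apply/allP.
Qed.

Lemma pmirror_iso a x y : pdot a a = 1 ->
  pdot (pmirror a x) (pmirror a y) = pdot x y.
Proof.
move=> a1; transitivity (pdot x y + 4 * pdot a x * pdot a y * (pdot a a - 1)).
  by rewrite /pmirror /pdot /=; ring.
by rewrite a1; ring.
Qed.

Lemma pmirror_id a : pdot a a = 1 -> pmirror a a = a.
Proof. by case: a => a1 a2 a1E; rewrite /pmirror a1E; congr pair => /=; ring. Qed.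

Lemma pmirrorK a x : pdot a a = 1 -> pmirror a (pmirror a x) = x.
Proof.
case: x => x1 x2 a1; have e : pdot a (pmirror a (x1, x2)) = pdot a (x1, x2).
  by rewrite -{1}(pmirror_id a1) pmirror_iso.
rewrite {1}/pmirror e.
by congr pair => /=; ring.
Qed.

Lemma pmirror_conj a x y : pdot a a = 1 ->
  pmirror a (pmirror x y) = pmirror (pmirror a x) (pmirror a y).
Proof.
move=> a1; rewrite [RHS]/pmirror pmirror_iso //.
by congr pair; rewrite /pmirror /pdot /=; ring.
Qed.

(** Two walks along consecutive directions leave [a] on opposite sides.  Each
    step is determined by the previous two directions through
    [consecutive_mirror], so the walks stay mirror images of each other, with
    the same weights, until the shorter one stops; there the mirror image of its
    end point is a direction. *)
Lemma mirror_walk w a l m x0 x1 y0 y1 :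
  even_weight w -> balanced w -> pdot a a = 1 ->
  consecutive x0 x1 -> consecutive y1 y0 ->
  path consecutive x1 l -> path (fun u v => consecutive v u) y1 m ->
  y0 = pmirror a x0 -> y1 = pmirror a x1 -> w y0 = w x0 -> w y1 = w x1 ->
  exists2 z, z = last x1 l \/ z = last y1 m &
    pmirror a z \in A /\ w (pmirror a z) = w z.
Proof.
move=> wN wB a1; elim: l m x0 x1 y0 y1 => [|x2 l IH] m x0 x1 y0 y1 x01 y10.
  move=> _ _ _ ey _ wy; exists x1; first by left.
  by rewrite -ey wy; have [] := consecutiveP y10.
case: m => [|y2 m].
  move=> _ _ _ ey _ wy; exists y1; first by right.
  by rewrite ey pmirrorK // -ey wy; have [] := consecutiveP x01.
move=> /= /andP[x12 pl] /andP[y21 pm] e0 e1 w0 w1.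
apply: (IH _ _ _ _ _ x12 y21 pl pm e1 _ w1).
  have [-> _] := consecutive_mirror x01 x12.
  have [_ ->] := consecutive_mirror y21 y10.
  by rewrite e1 e0 -pmirror_conj.
rewrite (consecutive_weight wN wB y21 y10) w0.
by rewrite (consecutive_weight wN wB x01 x12).
Qed.

(** If [b] is on the left of [a], a walk from [a] to [b] and one from [- b] to
    [a], the latter reversed, are compared by [mirror_walk].  Whichever is
    shorter, one of [b] and [- b] is mirrored to a direction. *)
Lemma planar_mirror w a b : even_weight w -> balanced w ->
  a \in A -> b \in A -> pmirror a b \in A /\ w (pmirror a b) = w b.
Proof.
move=> wN wB aA; have a1 := unitA aA.
have mirrorN x : pmirror a (- x) = - pmirror a x.
  rewrite /pmirror /pdot /=; congr pair => /=; ring.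
have half b' : b' \in A -> 0 < pdet a b' ->
    pmirror a b' \in A /\ w (pmirror a b') = w b'.
  move=> bA ab.
  have pos_neq x : 0 < pdet x x -> False by rewrite /pdet; lra.
  have Nba : 0 < pdet (- b') a by move: ab; rewrite /pdet /=; lra.
  have [[|x1 l] pl lb] := consecutive_path aA bA ab.
    by case: (pos_neq a); move: lb => /= lb; rewrite {2}lb.
  have [l' pl' la] := consecutive_path (oppA bA) aA Nba.
  have : path (fun u v => consecutive v u) a (rev (belast (- b') l')).
    by rewrite -la rev_path; apply: sub_path pl'.
  have : last a (rev (belast (- b') l')) = - b'.
    case: l' la {pl'} => [/= la|c l' _]; last by rewrite /= rev_cons last_rcons.
    by case: (pos_neq a); rewrite -{1}la.
  case: (rev _) => [/= e|y1 m lm /= /andP[y1a pm]].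
    by case: (pos_neq a); rewrite {1}e.
  move: pl => /= /andP[ax1 pl].
  have [_ ey] := consecutive_mirror y1a ax1.
  have [z zE] := mirror_walk wN wB a1 ax1 y1a pl pm (esym (pmirror_id a1)) ey erefl
    (consecutive_weight wN wB y1a ax1).
  case: zE => ->; first by rewrite -[last x1 l]/(last a (x1 :: l)) lb.
  rewrite -[last y1 m]/(last a (y1 :: m)) lm mirrorN => -[bm wm].
  have bm' : pmirror a b' \in A by rewrite -[pmirror a b']opprK oppA.
  by move: wm; rewrite !wN.
move=> bA; case: (ltgtP (pdet a b) 0) => ab.
- have [|h1 h2] := half _ (oppA bA); first by move: ab; rewrite /pdet /=; lra.
  have bm : pmirror a b \in A by rewrite -[pmirror a b]opprK -mirrorN oppA.
  by move: h2; rewrite mirrorN !wN.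
- exact: half.
- have [->|->] := pdet0_unit a1 (unitA bA) ab; first by rewrite pmirror_id.
  by rewrite mirrorN pmirror_id // oppA.
Qed.

End PlanarConfigurations.

(** * Weighted directions with equidistant signed sums *)

Section Configurations.
Variables (R : realType) (d : nat) (U : seq 'cV[R]_d).
Implicit Types (w : 'cV[R]_d -> R) (c u v e x : 'cV[R]_d).

Definition generic c := {in U, forall x, dot c x != 0}.

(** The point at which [c] is maximal on the sum of the segments from
    [- w x *: x] to [w x *: x], when [c] is generic. *)
Definition signed_sum w c : 'cV[R]_d :=
  \sum_(x <- U) (w x * Num.sg (dot c x)) *: x.

Definition equidistant w := forall c c', generic c -> generic c' ->
  dot (signed_sum w c) (signed_sum w c) = dot (signed_sum w c') (signed_sum w c').

Hypotheses (uniqU : uniq U) (unitU : {in U, forall x, dot x x = 1})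
  (oppU : {in U, forall x, - x \in U}).

(** On the two sides of the wall orthogonal to [u] the signed sums are
    [signed_sum w c + k *: u] and [signed_sum w c - k *: u] for some [k > 0];
    they have the same norm. *)
Lemma wall_orthogonal w c u : {in U, forall x, 0 < w x} -> equidistant w ->
  u \in U -> dot c u = 0 ->
  {in U, forall x, dot c x = 0 -> x = u \/ x = - u} ->
  dot u (signed_sum w c) = 0.
Proof.
move=> w_gt0 wE uU cu cU; have u1 := unitU uU.
pose k := \sum_(x <- U | dot c x == 0) w x.
have k_gt0 : 0 < k.
  rewrite /k (big_rem u) //= cu eqxx ltr_pwDl ?w_gt0 //.
  rewrite big_seq_cond sumr_ge0 // => x /andP[/mem_rem xU _].
  exact/ltW/w_gt0.
have side v : v = u \/ v = - u -> exists c', generic c' /\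
    signed_sum w c' = signed_sum w c + k *: v.
  move=> vu; have v1 : dot v v = 1 by case: vu => ->; rewrite ?dotNl ?dotNr ?opprK.
  have cv x : x \in U -> dot c x = 0 -> x = v \/ x = - v.
    by move=> xU /cU -/(_ xU); case: vu => -> [] ->; rewrite ?opprK; auto.
  have [a ha] := perturb c v U; exists (c + a *: v); split=> [x xU|].
    rewrite -sgr_eq0 ha //; case: ifPn => [/eqP c0|]; last by rewrite sgr_eq0.
    by case: (cv x xU c0) => ->; rewrite ?dotNr v1 ?sgrN sgr1 ?oppr_eq0 oner_eq0.
  rewrite /signed_sum [in LHS](bigID (fun x => dot c x == 0)) /=.
  rewrite [in RHS](bigID (fun x => dot c x == 0)) /=.
  rewrite [X in _ = X + _ + _]big1 => [|x /eqP ->]; last by rewrite sgr0 mulr0 scale0r.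
  rewrite add0r addrC /k scaler_suml; congr (_ + _).
    rewrite big_seq_cond [RHS]big_seq_cond; apply: eq_bigr => x /andP[xU].
    by rewrite ha // => /negPf ->.
  rewrite big_seq_cond [RHS]big_seq_cond; apply: eq_bigr => x /andP[xU c0].
  rewrite ha // c0; case: (cv x xU (eqP c0)) => ->.
    by rewrite v1 sgr1 mulr1.
  by rewrite dotNr v1 sgrN sgr1 mulrN1 scaleNr scalerN opprK.
have [c1 [g1 s1]] := side u (or_introl erefl).
have [c2 [g2 s2]] := side (- u) (or_intror erefl).
have := wE _ _ g1 g2; rewrite s1 s2 !dot_lin u1 (dotC _ u) => h.
have : k * dot u (signed_sum w c) = 0 by lra.
by move/eqP; rewrite mulf_eq0 gt_eqF //= => /eqP.
Qed.

(** By [wall_orthogonal] the inner product of [u] with the signed sum vanishes at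
    generic points of the hyperplane orthogonal to [u].  As a combination of
    signs on that hyperplane it has no jump orthogonally to [e], where only the
    directions in the plane spanned by [u] and [e] change sign. *)
Lemma plane_balanced w u e : {in U, forall x, 0 < w x} -> equidistant w ->
  u \in U -> dot e e = 1 -> dot u e = 0 ->
  \sum_(x <- U | x == dot u x *: u + dot e x *: e)
    w x * (Num.sg (dot e x) * dot u x) = 0.
Proof.
move=> w_gt0 wE uU e1 ue; have u1 := unitU uU.
pose f x : 'cV[R]_d := x - dot u x *: u.
have ef x : dot e (f x) = dot e x by rewrite /f !dot_lin (dotC e u) ue mulr0 subr0.
have uf x : dot u (f x) = 0 by rewrite /f !dot_lin u1; ring.
have fC c x : dot c (f x) = dot (f c) x by rewrite /f !dot_lin (dotC u c); ring.
have J := @sign_sum_jump R d _ U f (fun x => w x * dot u x) 0 e _ e1.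
rewrite -[RHS]J => [|c cU].
  apply: eq_big => [x|x _]; last by rewrite ef; ring.
  by rewrite ef /f subr_eq addrC.
rewrite -[RHS](@wall_orthogonal w (f c) u) // => [||x xU cx].
- rewrite /signed_sum dot_sumr; apply: eq_bigr => x _.
  by rewrite dotZr fC; ring.
- by rewrite dotC uf.
have : f x = 0 by apply: contra_eq cx => fx; rewrite -fC cU.
move/eqP; rewrite subr_eq0 => /eqP xE.
have := unitU xU; rewrite {1 2}xE !dotZl !dotZr u1 mulr1 -expr2 => /eqP.
by rewrite sqrf_eq1 => /orP[]/eqP x1; [left|right];
  rewrite xE x1 ?scale1r ?scaleN1r.
Qed.

(** In an orthonormal basis of the plane spanned by [u] and [x], the directions
    lying in that plane form a balanced planar configuration, for both weights. *)
Theorem equidistant_reflection w u x : {in U, forall x, 0 < w x} ->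
  {in U, forall x, w (- x) = w x} ->
  equidistant w -> equidistant (fun=> 1) -> u \in U -> x \in U ->
  reflection u *m x \in U /\ w (reflection u *m x) = w x.
Proof.
move=> w_gt0 wN wE oneE uU; have u1 := unitU uU.
move: x => b bU; rewrite reflection_unit //.
pose f : 'cV[R]_d := b - dot u b *: u.
have [f0|f0] := eqVneq f 0.
  have bE : b = dot u b *: u by apply/eqP; rewrite -subr_eq0 -/f f0.
  have -> : b - (2 * dot u b) *: u = - b.
    by rewrite [in X in X - _]bE [in RHS]bE -scalerBl -scaleNr; congr (_ *: _); ring.
  by rewrite oppU // wN.
have [r [e [e1 ue bE]]] : exists r e,
    [/\ dot e e = 1, dot u e = 0 & b = dot u b *: u + r *: e].
  have ff : 0 < dot f f by rewrite dot_gt0.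
  have r0 : Num.sqrt (dot f f) != 0 by rewrite gt_eqF // sqrtr_gt0.
  exists (Num.sqrt (dot f f)), ((Num.sqrt (dot f f))^-1 *: f); split.
  - by rewrite dotZl dotZr -{3}(sqr_sqrtr (ltW ff)); field.
  - by rewrite !dot_lin u1; ring.
  - by rewrite scalerA divff // scale1r addrC subrK.
pose emb (p : R * R) : 'cV[R]_d := p.1 *: u + p.2 *: e.
pose pt x := (dot u x, dot e x).
pose P x := x == emb (pt x).
have emb1 p : dot u (emb p) = p.1 by rewrite !dot_lin u1 ue; ring.
have emb2 p : dot e (emb p) = p.2 by rewrite !dot_lin e1 (dotC e u) ue; ring.
have embK p : pt (emb p) = p by rewrite /pt emb1 emb2 -surjective_pairing.
have embP p : P (emb p) by rewrite /P embK.
have embN p : emb (- p) = - emb p by rewrite /emb /= !scaleNr opprD.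
have embD p q : dot (emb p) (emb q) = pdot p q.
  by rewrite {2}/emb dotDr !dotZr !(dotC (emb p)) emb1 emb2 /pdot; ring.
pose A := [seq pt x | x <- U & P x].
have memA p : (p \in A) = (emb p \in U).
  apply/mapP/idP => [[x]|pU]; last first.
    by exists (emb p); rewrite ?mem_filter ?embP ?embK.
  by rewrite mem_filter => /andP[/eqP Px xU] ->; rewrite -Px.
have sumA (F : R * R -> R) : \sum_(p <- A) F p = \sum_(x <- U | P x) F (pt x).
  by rewrite /A big_map big_filter.
have uniqA : uniq A.
  rewrite map_inj_in_uniq ?filter_uniq // => x y; rewrite !mem_filter.
  by move=> /andP[/eqP -> _] /andP[/eqP -> _] /(congr1 emb); rewrite !embK.
have unitA : {in A, forall p, pdot p p = 1}.
  by move=> p; rewrite memA -embD => /unitU.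
have oppA : {in A, forall p, - p \in A}.
  by move=> p; rewrite !memA embN => /oppU.
have balA w' : {in U, forall x, 0 < w' x} -> equidistant w' ->
    balanced A (fun p => w' (emb p)).
  move=> w'_gt0 w'E a aA; have a1 := unitA _ aA.
  (* The quarter turn of [a] in the plane. *)
  pose e' := emb (- a.2, a.1).
  have := @plane_balanced w' (emb a) e' w'_gt0 w'E.
  rewrite -memA /e' !embD /pdot /= => /(_ aA) H; rewrite sumA -[RHS]H; last 2 first.
  - by move: a1; rewrite /pdot; lra.
  - by ring.
  have pe x : dot (emb (- a.2, a.1)) x = pdet a (pt x).
    by rewrite /emb /pdet !dot_lin /=; ring.
  have pa x : dot (emb a) x = pdot a (pt x).
    by rewrite /emb /pdot !dot_lin /=; ring.
  apply: eq_big => x; last by move=> /eqP Px; rewrite pe pa -Px.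
  rewrite pe pa; set y := (X in _ = (x == X)).
  have -> : y = emb (pdot a (pt x) * a.1 - pdet a (pt x) * a.2,
                     pdot a (pt x) * a.2 + pdet a (pt x) * a.1).
    rewrite /y /emb /= !scalerDr !scalerA !scalerDl mulrN scaleNr.
    by rewrite -!addrA; congr (_ + _); rewrite addrCA.
  by rewrite -pair_decomp.
have bP : b = emb (pt b).
  by rewrite [in RHS]bE [in LHS]bE -[_ + _]/(emb (dot u b, r)) embK.
have uE : u = emb (1, 0) by rewrite /emb scale1r scale0r addr0.
have uA : (1, 0) \in A by rewrite memA -uE.
have bA : pt b \in A by rewrite memA -bP.
have evA : even_weight A (fun p => w (emb p)).
  by move=> p; rewrite memA embN => /wN.
have one_gt0 : {in U, forall x : 'cV[R]_d, 0 < (1 : R)} by [].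
(* The planar mirror of [b] is the opposite of its reflection along [u]. *)
have mE : emb (pmirror (1, 0) (pt b)) = - (b - (2 * dot u b) *: u).
  transitivity (dot u b *: u + (- dot e b) *: e).
    by rewrite /emb; congr (_ *: _ + _ *: _); rewrite /pmirror /pdot /=; ring.
  rewrite opprB [X in _ = _ - X]bP /emb /= opprD addrA -scalerBl scaleNr.
  by congr (_ *: _ - _); ring.
have [] := planar_mirror uniqA unitA oppA (balA _ one_gt0 oneE) evA
  (balA _ w_gt0 wE) uA bA.
rewrite memA mE.
move=> mU; rewrite -bP => wm.
have rU : b - (2 * dot u b) *: u \in U by rewrite -[X in X \in U]opprK oppU.
by split=> //; rewrite -wm wN.
Qed.

End Configurations.

(** * Chambers of a root system *)

Section RootSystems.
Variables (R : realType) (d : nat).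
Implicit Types (c u v x r : 'cV[R]_d) (S T : 'M[R]_d) (l : seq 'cV[R]_d).

Definition word l : 'M[R]_d := foldr (fun r T => reflection r *m T) 1%:M l.

Lemma word_cat l1 l2 : word (l1 ++ l2) = word l1 *m word l2.
Proof.
by elim: l1 => [|r l1 IH] /=; rewrite ?mul1mx // -/(word _) IH mulmxA.
Qed.

Variables (U : seq 'cV[R]_d) (c0 : 'cV[R]_d).
Hypotheses (uniqU : uniq U) (unitU : {in U, forall x, dot x x = 1})
  (oppU : {in U, forall x, - x \in U})
  (reflU : {in U &, forall u x, reflection u *m x \in U})
  (c0U : generic U c0).

(** The simple roots of the chamber of [c0], recognised by the property that the
    reflection along them permutes the other positive roots. *)
Definition simple r := [&& r \in U, 0 < dot c0 r &
  all (fun u => (0 < dot c0 u) && (u != r) ==> (0 < dot c0 (reflection r *m u))) U].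

Lemma simpleP r : simple r -> [/\ r \in U, dot r r = 1, 0 < dot c0 r &
  forall u, u \in U -> 0 < dot c0 u -> u != r -> 0 < dot c0 (reflection r *m u)].
Proof.
case/and3P=> rU c0r /allP H; split; rewrite ?unitU // => u uU c0u ur.
by have := H u uU; rewrite c0u ur.
Qed.

(** Let [m] be the positive root at which the quotient of [dot x] by [dot c0] is
    minimal.  If the reflection along [m] made another positive root [u]
    negative, then [m] would be a positive combination of the positive roots [u]
    and [- (reflection m *m u)], and its quotient would lie between theirs.
    After perturbing [x] so that distinct positive roots have distinct
    quotients, this is impossible: [m] is simple, and the minimal quotient is
    positive. *)
Lemma simple_dominant x : generic U x ->
  (forall r, simple r -> 0 < dot x r) ->
  forall u, u \in U -> 0 < dot c0 u -> 0 < dot x u.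
Proof.
move=> xU xs u0 u0U c0u0.
(* [dot x (g u v) <> 0] means that [u] and [v] have distinct quotients. *)
pose g u v := dot c0 v *: u - dot c0 u *: v.
have [x' hx'] := perturb_generic x (U ++ [seq g u v | u <- U, v <- U]).
have sgx u : u \in U -> Num.sg (dot x' u) = Num.sg (dot x u).
  by move=> uU; apply: (hx' u _).1; rewrite ?mem_cat ?uU // xU.
have posx u : u \in U -> (0 < dot x' u) = (0 < dot x u).
  by move=> uU; rewrite -sgr_gt0 sgx // sgr_gt0.
pose F u := dot x' u / dot c0 u.
have u0p : u0 \in [seq u <- U | 0 < dot c0 u] by rewrite mem_filter c0u0.
have [m] := exists_min F u0p; rewrite mem_filter => /andP[c0m mU] mmin.
have Fle u : u \in U -> 0 < dot c0 u -> dot x' m * dot c0 u <= dot x' u * dot c0 m.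
  move=> uU c0u; have := mmin u; rewrite mem_filter c0u uU => /(_ isT).
  by rewrite /F ler_pdivrMr // mulrAC ler_pdivlMr.
have simple_m : simple m.
  rewrite /simple mU c0m; apply/allP => u uU; apply/implyP => /andP[c0u um].
  rewrite ltNge; apply/negP => c0su.
  have suU : - (reflection m *m u) \in U by rewrite oppU // reflU.
  have {}c0su : 0 < dot c0 (- (reflection m *m u)).
    by rewrite lt_neqAle eq_sym c0U // dotNr oppr_ge0.
  have := Fle _ suU c0su; have := Fle _ uU c0u; rewrite le_eqVlt.
  have m1 := unitU mU.
  case/predU1P => [e|]; last by rewrite reflection_unit // !dot_lin; nra.
  have : dot x' (g u m) = 0 by rewrite /g !dot_lin; lra.
  have [] := hx' (g u m).
    by rewrite mem_cat; apply/orP; right; apply: allpairs_f.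
  move=> _ gx' g0; case/negP: um; apply/eqP.
  have {gx' g0} : g u m = 0 by apply: contra_eq g0.
  move/eqP; rewrite subr_eq0 => /eqP um.
  have {}um : u = (dot c0 u / dot c0 m) *: m.
    by rewrite mulrC -scalerA -um scalerA mulVf ?scale1r // gt_eqF.
  have k0 : 0 < dot c0 u / dot c0 m by rewrite divr_gt0.
  have := unitU uU; rewrite {1 2}um dotZl dotZr m1 mulr1 -expr2 => /eqP.
  rewrite sqrf_eq1 => /orP[/eqP k1|/eqP k1]; last by exfalso; move: k0; rewrite k1; lra.
  by rewrite um k1 scale1r.
rewrite -posx // -(pmulr_lgt0 _ c0m); apply: lt_le_trans (Fle _ u0U c0u0).
by rewrite mulr_gt0 // posx // xs.
Qed.

Lemma generic_reflection r x : r \in U -> generic U x ->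
  generic U (reflection r *m x).
Proof.
by move=> rU xU u uU; rewrite dot_reflection ?unitU // xU // reflU.
Qed.

(** Reflecting [x] along a simple root on which it is negative decreases by one
    the number of positive roots on which it is negative. *)
Lemma word_dominant x : generic U x ->
  exists2 l, all simple l &
    forall u, u \in U -> 0 < dot c0 u -> 0 < dot (word l *m x) u.
Proof.
pose neg y u := (0 < dot c0 u) && (dot y u < 0).
have [n] := ubnP (count (neg x) U); elim: n x => // n IH x; rewrite ltnS => Hn xU.
have [/hasP[r rU /andP[sr xr]]|/hasPn xs] :=
    boolP (has (fun r => simple r && (dot x r < 0)) U); last first.
  exists [::] => // u uU c0u; rewrite /= mul1mx; apply: simple_dominant uU c0u => //.
  move=> r sr; have [rU _ _ _] := simpleP sr; have := xs r rU.
  by rewrite sr -leNgt /= lt_neqAle eq_sym xU.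
have [_ r1 c0r s_pos] := simpleP sr.
have [||l sl hl] := IH (reflection r *m x); last 2 first.
- exact: generic_reflection.
- exists (rcons l r); first by rewrite all_rcons sr.
  by move=> u uU c0u; rewrite -cats1 word_cat /= mulmx1 -mulmxA hl.
apply: leq_trans Hn; rewrite -!size_filter.
set s := filter (neg (reflection r *m x)) U.
rewrite -(size_map (mulmx (reflection r)) s).
apply: (@uniq_leq_size _ (r :: map (mulmx (reflection r)) s)).
  rewrite /= map_inj_uniq ?filter_uniq ?andbT //; last first.
    by apply: (can_inj (g := mulmx (reflection r))) => y; rewrite reflectionK.
  apply/mapP => -[u]; rewrite mem_filter => /andP[/andP[c0u _] _] ru.
  move: c0u; rewrite -[u](reflectionK _ r1) -ru reflection_self // dotNr.
  by rewrite oppr_gt0 ltNge ltW.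
move=> v; rewrite inE mem_filter => /predU1P[->|/mapP[u]].
  by rewrite /neg c0r xr.
rewrite mem_filter => /andP[/andP[c0u xu] uU] ->.
rewrite reflU // andbT /neg -(dot_reflection x u r1) xu andbT s_pos //.
apply: contraTneq xu => ->; rewrite dot_reflection // reflection_self // dotNr.
by rewrite oppr_lt0 -leNgt ltW.
Qed.

Lemma word_orthogonal l : all simple l -> orthogonal_group (word l).
Proof.
elim: l => [_|r l IH /= /andP[/simpleP[_ r1 _ _] /IH oT]]; first exact: orthogonal1.
by apply: orthogonalM => //; apply: reflection_orthogonal.
Qed.

Lemma word_stable l u : all simple l -> u \in U -> word l *m u \in U.
Proof.
elim: l => [_ uU|r l IH /= /andP[/simpleP[rU _ _ _] sl] uU]; first by rewrite mul1mx.
by rewrite -mulmxA reflU // IH.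
Qed.

(** The exchange property.  The letter [a] of [l] at which the image of [r]
    becomes negative is itself that image, because [a] is the only positive
    root made negative by its own reflection; hence the letter [a] cancels
    against the reflection along [r]. *)
Lemma word_exchange l r : all simple l -> simple r ->
  dot c0 (word l *m r) < 0 ->
  exists l', [/\ all simple l', (size l' < size l)%N &
    word l *m reflection r = word l'].
Proof.
move=> sl /simpleP[rU r1 c0r _]; elim: l sl => [_|a l IH] /=.
  by rewrite mul1mx ltNge ltW.
rewrite -/(word l) => /andP[sa sl]; have [aU a1 c0a a_pos] := simpleP sa.
have lrU := word_stable sl rU; rewrite -!mulmxA => c0ar.
have [c0lr|c0lr] := ltP (dot c0 (word l *m r)) 0.
  have [l' [sl' size_l' el']] := IH sl c0lr.
  by exists (a :: l'); rewrite /= sa sl' -/(word l') -el'.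
exists l; split=> //.
have ea : word l *m r = a.
  apply: contraTeq c0ar => lra; rewrite -leNgt ltW // a_pos //.
  by rewrite lt_neqAle eq_sym c0U.
rewrite (reflection_conj (word_orthogonal sl) r1) ea.
by apply: mulmx_ext => x; rewrite -!mulmxA reflectionK.
Qed.

(** A nonempty word preserving positivity sends its last letter to a positive
    root, so without this letter it sends it to a negative one and the exchange
    property gives a shorter word for the same element. *)
Lemma word_free l : all simple l ->
  (forall u, u \in U -> 0 < dot c0 u -> 0 < dot c0 (word l *m u)) ->
  word l = 1%:M.
Proof.
have [n] := ubnP (size l); elim: n l => // n IH l.
case/lastP: l => [//|l r]; rewrite size_rcons ltnS all_rcons => Hn /andP[sr sl].
have [rU r1 c0r _] := simpleP sr.
have -> : word (rcons l r) = word l *m reflection r.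
  by rewrite -cats1 word_cat /= mulmx1.
move=> lr_pos; have : dot c0 (word l *m r) < 0.
  rewrite -oppr_gt0 -dotNr -mulmxN -(reflection_self r1) mulmxA.
  exact: lr_pos.
move=> /(word_exchange sl sr)[l' [sl' size_l' el']].
by rewrite el' in lr_pos *; apply: IH => //; apply: ltn_trans Hn.
Qed.

End RootSystems.

(** * Vertices of a zonotope *)

Section ZonotopeVertices.
Variables (R : realType) (d : nat).
Implicit Types (a b c v x : 'cV[R]_d).

Lemma segment_param a b x : segment a b x -> exists2 t : R, `|t| <= 1 &
  x = 2^-1 *: (a + b) + t *: (2^-1 *: (b - a)).
Proof.
pose S : set 'cV[R]_d := fun x => exists2 t : R, `|t| <= 1 &
  x = 2^-1 *: (a + b) + t *: (2^-1 *: (b - a)).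
have comb (k t t' : R) (p h : 'cV[R]_d) :
    k *: (p + t *: h) + (1 - k) *: (p + t' *: h) =
    p + (k * t + (1 - k) * t') *: h.
  rewrite !scalerDr addrACA -scalerDl addrC subrKC scale1r !scalerA -scalerDl.
  by rewrite addrC.
apply: (@smallest_sub _ _ _ S) => [y z k|y [] ->].
- rewrite !inE => -[t t1 ->] [t' t'1 ->].
  have k0 : 0 <= k%:num :> R by [].
  have k1 : k%:num <= 1 :> R by [].
  exists (k%:num * t + (1 - k%:num) * t').
    rewrite !ler_norml in t1 t'1 *; case/andP: t1 => ? ?; case/andP: t'1 => ? ?.
    by apply/andP; split; nra.
  exact: comb.
- exists (-1); first by rewrite normrN normr1.
  by apply/matrixP => i j; rewrite !mxE; field.
- exists 1; first by rewrite normr1.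
  by apply/matrixP => i j; rewrite !mxE; field.
Qed.

Lemma segment_endpoints a b : segment a b a /\ segment a b b.
Proof. by split; apply: sub_gen_smallest; [left|right]. Qed.

Definition sign_vertex n (g : 'I_n -> 'cV[R]_d) c : 'cV[R]_d :=
  \sum_i Num.sg (dot c (g i)) *: g i.

Definition gen_generic n (g : 'I_n -> 'cV[R]_d) c :=
  forall i, g i != 0 -> dot c (g i) != 0.

Lemma zonotope_param (Z : set 'cV[R]_d) : is_zonotope Z ->
  exists n (m : 'cV[R]_d) (g : 'I_n -> 'cV[R]_d),
    (forall x, Z x -> exists2 t : 'I_n -> R, (forall i, `|t i| <= 1) &
      x = m + \sum_i t i *: g i) /\
    (forall e : 'I_n -> bool, Z (m + \sum_i (-1) ^+ e i *: g i)).
Proof.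
move=> [_ [n [a [b ->]]]]; exists n, (\sum_i 2^-1 *: (a i + b i)).
exists (fun i => 2^-1 *: (b i - a i)); split=> [x [y yab <-]|e].
  have /choice[t ht] : forall i, exists t : R, `|t| <= 1 /\
      y i = 2^-1 *: (a i + b i) + t *: (2^-1 *: (b i - a i)).
    by move=> i; have [t ? ?] := segment_param (yab i); exists t.
  exists t => [i|]; first by have [] := ht i.
  by rewrite -big_split; apply: eq_bigr => i _; have [] := ht i.
exists (fun i => if e i then a i else b i) => [i|] /=.
  by have [] := segment_endpoints (a i) (b i); case: (e i).
rewrite -big_split; apply: eq_bigr => i _ /=.
by case: (e i); apply/matrixP => k j; rewrite !mxE /=; field.
Qed.

(** The point of [Z] maximising the centre [m] has its opposite in [Z]; comparing
    with the minimum of [m] on [Z] gives [dot m m <= 0]. *)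
Lemma zonotope_centered (Z : set 'cV[R]_d) : is_zonotope Z ->
  [set - x | x in Z] = Z ->
  exists n (g : 'I_n -> 'cV[R]_d),
    (forall x, Z x -> exists2 t : 'I_n -> R, (forall i, `|t i| <= 1) &
      x = \sum_i t i *: g i) /\
    (forall e : 'I_n -> bool, Z (\sum_i (-1) ^+ e i *: g i)).
Proof.
move=> /zonotope_param[n [m [g [Zin Zend]]]] Zsym.
suff m0 : m = 0.
  exists n, g; split=> [x /Zin[t t1 ->]|e]; last by have := Zend e; rewrite m0 add0r.
  by exists t => //; rewrite m0 add0r.
pose top := m + \sum_i (-1) ^+ (dot m (g i) < 0)%R *: g i.
have : Z (- top) by rewrite -Zsym; exists top => //; apply: Zend.
move=> /Zin[t t1] /(congr1 (dot m)).
rewrite dotNr !dotDr !dot_sumr => h.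
have le_t : - \sum_i dot m ((-1) ^+ (dot m (g i) < 0)%R *: g i) <=
    \sum_i dot m (t i *: g i).
  rewrite -sumrN; apply: ler_sum => i _; rewrite !dotZr.
  have := t1 i; rewrite ler_norml => /andP[? ?].
  by case: ltP => ? /=; rewrite ?expr1 ?expr0; nra.
apply/eqP; rewrite -dot_eq0 eq_le dot_ge0 andbT.
by move: h le_t; lra.
Qed.

(** If the maximum of [c] is attained at a single point, no generator [g i <> 0]
    is orthogonal to [c]: otherwise changing the sign of [g i] in a maximiser
    would give another one. *)
Lemma vertices_sign (Z : set 'cV[R]_d) n (g : 'I_n -> 'cV[R]_d) :
  (forall x, Z x -> exists2 t : 'I_n -> R, (forall i, `|t i| <= 1) &
      x = \sum_i t i *: g i) ->
  (forall e : 'I_n -> bool, Z (\sum_i (-1) ^+ e i *: g i)) ->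
  (forall c v, Z v -> (forall x, Z x -> x <> v -> dot c x < dot c v) ->
    gen_generic g c /\ v = sign_vertex g c) /\
  (forall c, gen_generic g c -> Z (sign_vertex g c) /\
    forall x, Z x -> x <> sign_vertex g c -> dot c x < dot c (sign_vertex g c)).
Proof.
move=> Zin Zend; split=> [c v Zv vmax|c gc].
  have maxE (e : 'I_n -> bool) :
      (forall i, (-1) ^+ e i * dot c (g i) = `|dot c (g i)|) ->
      \sum_i (-1) ^+ e i *: g i = v.
    move=> he; apply: contrapT => /(vmax _ (Zend e)); apply/negP; rewrite -leNgt.
    have [t t1 ->] := Zin v Zv; rewrite !dot_sumr; apply: ler_sum => i _.
    rewrite !dotZr he; apply: le_trans (ler_norm _) _.
    by rewrite normrM ler_piMl.
  pose e i := dot c (g i) < 0.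
  have he i : (-1) ^+ e i * dot c (g i) = `|dot c (g i)|.
    rewrite /e; case: ltP => h /=; first by rewrite expr1 mulN1r ltr0_norm.
    by rewrite expr0 mul1r ger0_norm.
  have gc : gen_generic g c.
    move=> i gi0; apply/negP => /eqP ci.
    (* Flipping the sign of [g i] gives another maximiser. *)
    pose e' j := if j == i then ~~ e i else e j.
    have he' j : (-1) ^+ e' j * dot c (g j) = `|dot c (g j)|.
      by rewrite /e'; case: eqP => [->|_ //]; rewrite ci mulr0 normr0.
    have := maxE _ he; rewrite -(maxE _ he') (bigD1 i) //= [RHS](bigD1 i) //=.
    rewrite [X in _ = _ + X](_ : _ = \sum_(j < n | j != i) (-1) ^+ e j *: g j).
      move/addIr => /eqP; rewrite /e' eqxx -subr_eq0 -scalerBl scaler_eq0.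
      by rewrite (negPf gi0) orbF; case: (e i) => /=; rewrite ?expr0 ?expr1; lra.
    by apply: eq_bigr => j /negPf ji; rewrite /e' ji.
  split=> //; rewrite -(maxE _ he); apply: eq_bigr => i _.
  have [->|/gc ci] := eqVneq (g i) 0; first by rewrite !scaler0.
  by rewrite /e sgr_def ci.
have Zc : Z (sign_vertex g c).
  rewrite [sign_vertex g c](_ : _ = \sum_i (-1) ^+ (dot c (g i) < 0)%R *: g i) //.
  apply: eq_bigr => i _.
  have [->|/gc ci] := eqVneq (g i) 0; first by rewrite !scaler0.
  by rewrite sgr_def ci.
split=> // x /Zin[t t1 ->] xv; rewrite lt_neqAle.
have le_i i : dot c (t i *: g i) <= dot c (Num.sg (dot c (g i)) *: g i).
  rewrite !dotZr -normrEsg; apply: le_trans (ler_norm _) _.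
  by rewrite normrM ler_piMl.
apply/andP; split; last by rewrite !dot_sumr; apply: ler_sum.
apply/negP => /eqP; rewrite !dot_sumr => /esym/eqP; rewrite -subr_eq0 -sumrB.
rewrite psumr_eq0 => [/allP h|i _]; last by rewrite subr_ge0.
apply: xv; apply: eq_bigr => i _.
have [->|/gc ci] := eqVneq (g i) 0; first by rewrite !scaler0.
have := h i (mem_index_enum i); rewrite subr_eq0 !dotZr => /eqP/(mulIf ci) -> //.
Qed.

End ZonotopeVertices.

(** * Unit directions and weights of the generators *)

Section GeneratorWeights.
Variables (R : realType) (d n : nat) (g : 'I_n -> 'cV[R]_d).
Implicit Types (c u v x : 'cV[R]_d) (T : 'M[R]_d).

Definition along x i := g i == dot x (g i) *: x.

(** Half the total length, as each direction will be counted together with its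
    opposite. *)
Definition weight x : R := (\sum_(i | along x i) `|dot x (g i)|) / 2.

Definition direction i : 'cV[R]_d := (Num.sqrt (dot (g i) (g i)))^-1 *: g i.

Definition directions : seq 'cV[R]_d :=
  let s := [seq direction i | i <- enum 'I_n & g i != 0] in
  undup (s ++ map -%R s).

Lemma alongN x i : along (- x) i = along x i.
Proof. by rewrite /along dotNl scaleNr scalerN opprK. Qed.

Lemma weightN x : weight (- x) = weight x.
Proof.
rewrite /weight; congr (_ / _); apply: eq_big => i; first exact: alongN.
by rewrite dotNl normrN.
Qed.

Lemma weight_gt0P x : reflect (exists2 i, g i != 0 & along x i) (0 < weight x).
Proof.
rewrite /weight pmulr_lgt0 ?invr_gt0 //; apply: (iffP idP) => [|[i gi0 xi]].
  rewrite lt_neqAle sumr_ge0 // andbT eq_sym psumr_neq0 // => /hasP[i _].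
  case/andP=> xi; rewrite normr_gt0 => xgi; exists i => //.
  by apply: contraNneq xgi => ->; rewrite dot0r.
rewrite (bigD1 i) //= ltr_pwDl ?sumr_ge0 // normr_gt0.
by apply: contraNneq gi0 => xgi; rewrite (eqP xi) xgi scale0r.
Qed.

Lemma mem_directions x : (x \in directions) = (dot x x == 1) && (0 < weight x).
Proof.
have dir1 i : g i != 0 -> dot (direction i) (direction i) = 1 /\ along (direction i) i.
  rewrite -dot_gt0 => gi0; have r2 := sqr_sqrtr (ltW gi0).
  have r0 : Num.sqrt (dot (g i) (g i)) != 0 by rewrite gt_eqF // sqrtr_gt0.
  rewrite /along /direction !dotZl !dotZr; set r := Num.sqrt _ in r0 r2 *.
  rewrite -r2 scalerA; split; first by field.
  by rewrite [X in X *: _](_ : _ = 1) ?scale1r //; field.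
rewrite mem_undup mem_cat; apply/idP/andP => [|[/eqP x1 /weight_gt0P[i gi0 xi]]].
  have H i : g i != 0 -> (dot (direction i) (direction i) == 1) /\
      0 < weight (direction i).
    by move=> gi0; have [-> di] := dir1 i gi0; split=> //; apply/weight_gt0P; exists i.
  case/orP => /mapP[y]; first by rewrite mem_filter => /andP[y0 _] ->; apply: H.
  case/mapP => i; rewrite mem_filter => /andP[gi0 _] -> ->.
  by have [] := H i gi0; rewrite dotNl dotNr opprK weightN.
have si : direction i \in [seq direction i | i <- enum 'I_n & g i != 0].
  by apply: map_f; rewrite mem_filter gi0 mem_enum.
pose t := dot x (g i).
have t0 : t != 0 by apply: contraNneq gi0 => t0; rewrite (eqP xi) -/t t0 scale0r.
have dE : direction i = (t / `|t|) *: x.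
  rewrite /direction [in LHS](eqP xi) -/t dotZl dotZr x1 mulr1 -expr2 sqrtr_sqr.
  by rewrite scalerA mulrC.
case: (ltgtP t 0) t0 => // t0 _.
  rewrite ltr0_norm // invrN mulrN divff ?lt_eqF // scaleN1r in dE.
  by apply/orP; right; apply/mapP; exists (direction i); rewrite // dE opprK.
rewrite gtr0_norm // divff ?gt_eqF // scale1r in dE.
by apply/orP; left; rewrite -dE.
Qed.

Lemma directions_unit : {in directions, forall x, dot x x = 1}.
Proof. by move=> x; rewrite mem_directions => /andP[/eqP]. Qed.

Lemma directions_opp : {in directions, forall x, - x \in directions}.
Proof. by move=> x; rewrite !mem_directions dotNl dotNr opprK weightN. Qed.

Lemma directions_weight : {in directions, forall x, 0 < weight x}.
Proof. by move=> x; rewrite mem_directions => /andP[]. Qed.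

Lemma generic_directions c : generic directions c <-> gen_generic g c.
Proof.
split=> [cU i gi0|cg x].
  have : direction i \in directions.
    by rewrite mem_undup mem_cat map_f // mem_filter gi0 mem_enum.
  by move/cU; apply: contraNneq => ci; rewrite dotZr ci mulr0.
rewrite mem_directions => /andP[_ /weight_gt0P[i gi0 xi]].
have := cg i gi0; rewrite {1}(eqP xi) dotZr mulf_eq0 negb_or.
by case/andP.
Qed.

(** A nonzero generator contributes to the two directions parallel to it, each
    time with half its length. *)
Lemma signed_sum_directions c : signed_sum directions weight c = sign_vertex g c.
Proof.
transitivity (\sum_(x <- directions) \sum_(i | along x i)
    2^-1 *: (Num.sg (dot c (g i)) *: g i)).
  rewrite /signed_sum; apply: eq_bigr => x _.
  rewrite /weight !mulr_suml scaler_suml; apply: eq_bigr => i /eqP xi.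
  rewrite [in RHS]xi dotZr sgrM !scalerA normrEsg.
  by congr (_ *: _); ring.
rewrite (exchange_big_dep predT) //=; apply: eq_bigr => i _.
have [->|gi0] := eqVneq (g i) 0.
  by rewrite scaler0 big1 // => x _; rewrite !scaler0.
set y := Num.sg _ *: _.
have uU : direction i \in directions.
  by rewrite mem_undup mem_cat map_f // mem_filter gi0 mem_enum.
have u1 := directions_unit uU; set u := direction i in uU u1 *.
have giu : g i = Num.sqrt (dot (g i) (g i)) *: u.
  by rewrite scalerA divff ?scale1r // gt_eqF // sqrtr_gt0 dot_gt0.
set r := Num.sqrt _ in giu.
have r0 : r != 0 by apply: contraNneq gi0 => r0; rewrite giu r0 scale0r.
have ui : along u i by rewrite /along giu dotZr u1 mulr1.
rewrite big_mkcond (@big_support _ _ _ [:: u; - u]) ?undup_uniq //=.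
- rewrite !big_cons big_nil alongN ui addr0 -scalerDl.
  by rewrite [X in X *: _](_ : _ = 1) ?scale1r //; field.
- rewrite inE andbT; apply: contra_eqN u1 => /eqP uu.
  have -> : dot u u = - dot u u by rewrite {2}uu dotNr.
  by rewrite lt_eqF // (le_lt_trans _ ltr01) // oppr_le0 dot_ge0.
- by move=> x; rewrite !inE => /orP[]/eqP-> //; apply: directions_opp.
move=> x xU; rewrite !inE negb_or => /andP[xu xNu]; case: ifP => // /eqP xi.
have x1 := directions_unit xU.
have uE : u = (r^-1 * dot x (g i)) *: x by rewrite -scalerA -xi giu scalerA mulVf ?scale1r.
move: u1; rewrite {1 2}uE dotZl dotZr x1 mulr1 -expr2 => /eqP.
rewrite sqrf_eq1 => /orP[]/eqP k.
  by rewrite uE k scale1r eqxx in xu.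
by rewrite uE k scaleN1r opprK eqxx in xNu.
Qed.

(** The vertices are the signed sums of the generators [g i], and also of the
    generators [T *m g i].  The difference of the two families of sign functions
    vanishes, so by [sign_sum_jump] they have the same weight in each
    direction. *)
Lemma sign_vertex_weight T : orthogonal_group T ->
  (forall c, gen_generic g c -> gen_generic g (T *m c) /\
    T *m sign_vertex g c = sign_vertex g (T *m c)) ->
  forall x, dot x x = 1 -> weight (T *m x) = weight x.
Proof.
move=> oT Tv x x1.
have Tx1 : dot (T *m x) (T *m x) = 1 by rewrite dot_orthogonal.
pose f (k : 'I_n + 'I_n) := match k with inl i => g i | inr i => T *m g i end.
pose a (k : 'I_n + 'I_n) := match k with
  | inl i => dot (T *m x) (g i) | inr i => - dot (T *m x) (T *m g i) end.
have := @sign_sum_jump R d _ (index_enum _) f a 0 (T *m x) _ Tx1.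
rewrite !big_sumType /= => H.
have {}H := H _; rewrite /weight; congr (_ / _).
apply/eqP; rewrite -subr_eq0; apply/eqP; rewrite -[RHS]H.
  congr (_ + _); first by apply: eq_bigr => i _; rewrite -normrEsg.
  rewrite -sumrN; apply: eq_big => i; last first.
    by move=> _; rewrite mulrN -normrEsg dot_orthogonal.
  rewrite /along dot_orthogonal // scalemxAr; apply/eqP/eqP => [<-//|].
  by move/(congr1 (mulmx T^T)); rewrite !orthogonalK.
move=> c cf; have cg : gen_generic g (T^T *m c).
  by move=> i gi0; rewrite -dot_mulmx; apply: (cf (inr i)); rewrite ?mem_index_enum //=;
    apply: contraNneq gi0 => Tg0; rewrite -[g i](orthogonalK _ oT) Tg0 mulmx0.
have [_] := Tv _ cg; rewrite orthogonalKV // => vE.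
have := congr1 (dot (T *m x)) vE; rewrite dot_mulmx orthogonalK // !dot_sumr => e.
rewrite big_sumType /=; apply/eqP; rewrite addr_eq0; apply/eqP.
rewrite -sumrN; apply/esym; transitivity (\sum_i dot x (Num.sg (dot (T^T *m c) (g i)) *: g i)).
  by apply: eq_bigr => i _; rewrite mulrN opprK dotZr -dot_mulmx dot_orthogonal.
by rewrite e; apply: eq_bigr => i _; rewrite dotZr.
Qed.

End GeneratorWeights.

(** * Symmetries of signed sums *)

Section SignedSums.
Variables (R : realType) (d : nat) (U : seq 'cV[R]_d).
Hypotheses (uniqU : uniq U).
Implicit Types (w : 'cV[R]_d -> R) (c x : 'cV[R]_d) (T : 'M[R]_d).

Lemma signed_sum_equivariant T w c : orthogonal_group T ->
  {in U, forall x, T *m x \in U /\ w (T *m x) = w x} ->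
  T *m signed_sum U w c = signed_sum U w (T *m c).
Proof.
move=> oT TU.
have Tinj : injective (mulmx T : 'cV[R]_d -> 'cV[R]_d).
  exact: (can_inj (fun x => orthogonalK x oT)).
have TUsub : {subset map (mulmx T) U <= U}.
  by move=> _ /mapP[x xU ->]; have [] := TU x xU.
have permU : perm_eq (map (mulmx T) U) U.
  have uTU : uniq (map (mulmx T) U) by rewrite map_inj_uniq.
  by apply: uniq_perm => //; have [] := uniq_min_size uTU TUsub; rewrite ?size_map.
rewrite /signed_sum -[in RHS](perm_big _ permU) big_map mulmx_sumr.
rewrite big_seq [RHS]big_seq; apply: eq_bigr => x xU.
by rewrite -scalemxAr dot_orthogonal // (TU x xU).2.
Qed.

Lemma generic_orthogonal T c : orthogonal_group T ->
  {in U, forall x, T^T *m x \in U} -> generic U c -> generic U (T *m c).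
Proof.
by move=> oT TU cU x xU; rewrite dotC dot_mulmx dotC cU // TU.
Qed.

(** The linear form [c] is maximal at [signed_sum w c] among all signed sums, and
    a change of any sign makes it strictly smaller. *)
Lemma signed_sum_inj w c c' : {in U, forall x, 0 < w x} ->
  generic U c -> signed_sum U w c = signed_sum U w c' ->
  {in U, forall x, Num.sg (dot c x) = Num.sg (dot c' x)}.
Proof.
move=> w_gt0 cU /(congr1 (dot c)); rewrite !dot_sumr => /eqP.
rewrite -subr_eq0 -sumrB big_seq psumr_eq0 => [/allP H|x xU]; last first.
  rewrite !dotZr -mulrBl -mulrBr -mulrA pmulr_rge0 ?w_gt0 // mulrBl subr_ge0.
  rewrite -normrEsg; apply: le_trans (ler_norm _) _.
  by rewrite normrM ler_piMl // normr_sg; case: (_ != 0).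
move=> x xU; have := H x xU; rewrite xU /= !dotZr subr_eq0 => /eqP.
by move/(mulIf (cU x xU))/(mulfI (lt0r_neq0 (w_gt0 x xU))).
Qed.

Lemma signed_sum_sign w c c' :
  {in U, forall x, Num.sg (dot c x) = Num.sg (dot c' x)} ->
  signed_sum U w c = signed_sum U w c'.
Proof.
move=> cc'; rewrite /signed_sum big_seq [RHS]big_seq.
by apply: eq_bigr => x /cc' ->.
Qed.

Lemma finite_signed_sums w :
  finite_set [set signed_sum U w c | c in generic U].
Proof.
pose h (b : {ffun 'I_(size U) -> bool}) : 'cV[R]_d :=
  \sum_(i < size U) (w U`_i * (if b i then 1 else -1)) *: U`_i.
apply: (@sub_finite_set _ _ (h @` setT)); last exact/finite_image/finite_finset.
move=> _ [c cU <-]; exists [ffun i => 0 < dot c U`_(nat_of_ord i)] => //.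
rewrite /h /signed_sum (big_nth 0) big_mkord; apply: eq_bigr => i _.
rewrite ffunE; congr (_ * _ *: _).
have := cU _ (mem_nth 0 (ltn_ord i)).
by case: (ltgtP (dot c _) 0) => // h0 _; [rewrite ltr0_sg|rewrite gtr0_sg].
Qed.

End SignedSums.

(** * The group generated by the simple reflections *)

Section SimpleReflectionGroup.
Variables (R : realType) (d : nat) (U : seq 'cV[R]_d) (c0 : 'cV[R]_d).
Hypothesis unitU : {in U, forall x, dot x x = 1}.

Definition words : set 'M[R]_d :=
  [set word l | l in [set l | all (simple U c0) l]].

Lemma words_subgroup : is_orthogonal_subgroup words.
Proof.
have simple1 r : simple U c0 r -> dot r r = 1 by case/and3P => /unitU.
have orth_word l := @word_orthogonal _ _ U c0 unitU l.
split=> [_ [l sl <-]||_ _ [l1 s1 <-] [l2 s2 <-]|_ [l sl <-]].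
- exact: orth_word.
- by exists [::].
- by exists (l1 ++ l2); rewrite /= ?all_cat ?s1 // word_cat.
exists (rev l); first by rewrite /= all_rev.
rewrite (orthogonal_invmx (orth_word l sl)).
elim: l sl => [|r l IH /= /andP[sr sl]]; first by rewrite trmx1.
rewrite rev_cons -cats1 word_cat IH // /= mulmx1 trmx_mul; congr (_ *m _).
apply: mulmx_ext => x; apply: dot_ext => y.
by rewrite [RHS]dot_mulmx trmxK dot_reflection ?simple1.
Qed.

Lemma generated_words :
  generated_group [set reflection r | r in [set r | simple U c0 r]] = words.
Proof.
apply/seteqP; split.
  apply: smallest_sub => [|_ [r sr <-]]; first exact: words_subgroup.
  by exists [:: r]; rewrite /= ?mulmx1 ?sr.
move=> _ [l sl <-] G [[_ G1 GM _] XG]; elim: l sl => //= r l IH /andP[sr sl].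
by apply: GM; [apply: XG; exists r|apply: IH].
Qed.

End SimpleReflectionGroup.

(** * Vertex-transitive zonotopes *)

Lemma Aut_vertices (R : realType) (d : nat) (Z : set 'cV[R]_d) T c v :
  Aut Z T -> Z v -> (forall x, Z x -> x <> v -> dot c x < dot c v) ->
  Z (T *m v) /\
  (forall x, Z x -> x <> T *m v -> dot (T *m c) x < dot (T *m c) (T *m v)).
Proof.
move=> [oT TZ] Zv vmax; split=> [|x]; first by rewrite -TZ; exists v.
rewrite -{1}TZ => -[y Zy <-] yv; rewrite !dot_orthogonal //; apply: vmax => //.
by move=> yE; apply: yv; rewrite yE.
Qed.

Theorem zonotope_configuration (R : realType) (d : nat) (Z : set 'cV[R]_d) :
  is_zonotope Z -> [set - x | x in Z] = Z ->
  exists (U : seq 'cV[R]_d) (w : 'cV[R]_d -> R),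
    [/\ uniq U, {in U, forall x, dot x x = 1}, {in U, forall x, - x \in U},
      {in U, forall x, 0 < w x /\ w (- x) = w x} &
      vertices Z = [set signed_sum U w c | c in generic U] /\
      forall T, Aut Z T -> {in U, forall x, T *m x \in U /\ w (T *m x) = w x}].
Proof.
move=> hZ hsym; have [n [g [Zin Zend]]] := zonotope_centered hZ hsym.
have [vertex_sign sign_max] := vertices_sign Zin Zend.
exists (directions g), (weight g); split.
- exact: undup_uniq.
- exact: directions_unit.
- exact: directions_opp.
- by move=> x xU; rewrite weightN directions_weight.
split=> [|T hT].
  apply/seteqP; split=> [v [Zv [c vmax]]|_ [c /generic_directions cg <-]].
    have [cg ->] := vertex_sign c v Zv vmax.
    by exists c; [apply/generic_directions|apply: signed_sum_directions].
  by have [Zs smax] := sign_max c cg; rewrite signed_sum_directions; split=> //; exists c.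
have oT : orthogonal_group T by case: hT.
have wT := sign_vertex_weight oT.
have {}wT x : dot x x = 1 -> weight g (T *m x) = weight g x.
  apply: wT => c cg; have [Zs smax] := sign_max c cg.
  by have [ZT Tmax] := Aut_vertices hT Zs smax; apply: vertex_sign.
move=> x; rewrite !mem_directions => /andP[/eqP x1 wx].
by rewrite dot_orthogonal // x1 wT // eqxx wx.
Qed.

Theorem theorem4p11 (R : realType) (d : nat) (hd : (2 <= d)%N)
    (Z : set 'cV[R]_d) (hZ : is_zonotope Z) (hfull : full_dimensional Z)
    (hsym : [set - x | x in Z] = Z) (htrans : vertex_transitive Z) :
  exists G : set 'M[R]_d, finite_reflection_group G /\ is_permutahedron G Z.
Proof.
have [U [w [uniqU unitU oppU wU [VE AutU]]]] := zonotope_configuration hZ hsym.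
have w_gt0 : {in U, forall x, 0 < w x} by move=> x /wU[].
have wN : {in U, forall x, w (- x) = w x} by move=> x /wU[].
have vertexP c : generic U c -> vertices Z (signed_sum U w c).
  by rewrite VE => cU; exists c.
have [Aut_stable [v0] + trans] := htrans; rewrite {1}VE => -[c0 c0U v0E].
have oneU (T : 'M[R]_d) : {in U, forall x, T *m x \in U /\ w (T *m x) = w x} ->
    {in U, forall x, T *m x \in U /\ (1 : R) = 1}.
  by move=> TU x /TU[].
have wE : equidistant U w.
  move=> c c' cU c'U; have [T [oT _] <-] := trans _ _ (vertexP c cU) (vertexP c' c'U).
  by rewrite dot_orthogonal.
(* An automorphism carrying one vertex to another carries the chamber of the first
   to that of the second, hence does the same for the weight 1. *)
have oneE : equidistant U (fun=> 1).
  move=> c c' cU c'U; have [T hT TE] := trans _ _ (vertexP c cU) (vertexP c' c'U).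
  have oT : orthogonal_group T by case: hT.
  have TU := AutU T hT; rewrite (signed_sum_equivariant uniqU c oT TU) in TE.
  have same := signed_sum_inj w_gt0 c'U (esym TE).
  rewrite (signed_sum_sign _ same) -(signed_sum_equivariant uniqU _ oT (oneU T TU)).
  by rewrite dot_orthogonal.
have refl u x := @equidistant_reflection R d U uniqU unitU oppU w u x w_gt0 wN wE oneE.
have reflU : {in U &, forall u x, reflection u *m x \in U}.
  by move=> u x uU xU; have [] := refl u x uU xU.
pose W := words U c0.
have [Worth W1 WM Winv] : is_orthogonal_subgroup W by exact: words_subgroup.
have Wtr T : W T -> W T^T by move=> WT; rewrite -(orthogonal_invmx (Worth T WT)); apply: Winv.
have WU T : W T -> {in U, forall x, T *m x \in U /\ w (T *m x) = w x}.
  move=> [l sl <-]; elim: l sl => [_ x xU|r l IH /= /andP[/and3P[rU _ _] sl] x xU].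
    by rewrite mul1mx.
  have [lU lw] := IH sl x xU; rewrite -mulmxA.
  by have [-> ->] := refl r _ rU lU.
have Wsum T c : W T -> T *m signed_sum U w c = signed_sum U w (T *m c).
  by move=> WT; apply: signed_sum_equivariant => //; [exact: Worth|exact: WU].
have to_v0 v : vertices Z v -> exists2 T, W T & T *m v = v0.
  rewrite {1}VE => -[c cU <-].
  have [l sl hl] := word_dominant uniqU unitU oppU reflU c0U cU.
  have WT : W (word l) by exists l.
  exists (word l) => //; rewrite Wsum // -v0E; apply: signed_sum_sign => u uU.
  have := c0U u uU; case: (ltgtP (dot c0 u) 0) => // c0u _.
    have := hl _ (oppU _ uU); rewrite !dotNr !oppr_gt0 => /(_ c0u) lu.
    by rewrite !ltr0_sg.
  by rewrite !gtr0_sg // hl.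
have v0_free T : W T -> T *m v0 = v0 -> T = 1%:M.
  move=> WT Tv0; have oT := Worth T WT.
  have Ttv0 : T^T *m v0 = v0 by rewrite -{1}Tv0 orthogonalK.
  move: Ttv0; rewrite -v0E (Wsum _ _ (Wtr T WT)) => /esym/(signed_sum_inj w_gt0 c0U) sgT.
  case: WT oT sgT {Tv0} => l sl <- oT sgT.
  apply: (word_free unitU reflU c0U sl) => u uU c0u.
  by rewrite dot_mulmx -sgr_gt0 -sgT // sgr_gt0.
have V_finite : finite_set (vertices Z) by rewrite VE; apply: finite_signed_sums.
have W_vertices : acts_on W (vertices Z).
  move=> T v WT; rewrite VE => -[c cU <-]; exists (T *m c); last by rewrite Wsum.
  apply: generic_orthogonal cU; first exact: Worth.
  by move=> x xU; have [] := WU _ (Wtr T WT) x xU.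
have v0V : vertices Z v0 by rewrite -v0E; apply: vertexP.
have W_finite : finite_set W.
  (* [T] is determined by [T *m v0], because [v0_free] applies to the quotient of
     two such matrices. *)
  pose lift v := xget 1%:M [set T | W T /\ T *m v0 = v].
  apply: (@sub_finite_set _ _ (lift @` vertices Z)); last exact: finite_image.
  move=> T WT; exists (T *m v0); first exact: W_vertices.
  have [WS ST] : [set S | W S /\ S *m v0 = T *m v0] (lift (T *m v0)).
    by apply: xgetPex; exists T.
  have oT := Worth T WT; have : T^T *m lift (T *m v0) = 1%:M.
    apply: v0_free; first exact: WM _ _ (Wtr T WT) WS.
    by rewrite -mulmxA ST orthogonalK.
  by move/(congr1 (mulmx T)); rewrite mulmxA orthogonal_mulC // mul1mx mulmx1.
exists W; split.
  split=> //; exists [set r | simple U c0 r]; split.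
  - apply: (@sub_finite_set _ _ [set` U]); last exact: finite_seq.
    by move=> r /and3P[].
  - by move=> r /and3P[/unitU/unit_neq0].
  - by rewrite /W -(generated_words c0 unitU).
split; first by case: hZ.
split.
  split=> // [|v v' /to_v0[S WS Sv] /to_v0[S' WS' S'v']]; first by exists v0.
  exists (S'^T *m S); first exact: WM _ _ (Wtr S' WS') WS.
  by rewrite -mulmxA Sv -S'v' orthogonalK //; apply: Worth.
move=> T v WT vV Tv; have [S WS Sv] := to_v0 v vV; have oS := Worth S WS.
(* Freeness at [v] is transported to [v0] by conjugation with [S]. *)
have : S *m T *m S^T = 1%:M.
  apply: v0_free; first exact: WM _ _ (WM _ _ WS WT) (Wtr S WS).
  by rewrite -Sv -!mulmxA orthogonalK // Tv.
move/(congr1 (fun X => S^T *m X *m S)).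
by rewrite mulmx1 oS !mulmxA oS mul1mx -mulmxA oS mulmx1.
Qed.
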